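(* Let $A=A(R,\sigma,h,\xi)$ be an ambiskew polynomial ring over $\mathbb{K}$, let $(\Delta,\varepsilon,S)$ be a Hopf structure on $R$, and let $r_\pm,l_\pm,s_\pm\in R$. Then the formulas $$\Delta(X_\pm)=X_\pm\otimes r_\pm+l_\pm\otimes X_\pm,\qquad \varepsilon(X_\pm)=0,\qquad S(X_\pm)=s_\pm X_\pm$$ define a Hopf algebra structure on $A$ which extends that of $R$ if and only if all of the following conditions hold: 1. $(\sigma\otimes\mathrm{Id})\circ\Delta|_R=\Delta\circ\sigma|_R=(\mathrm{Id}\otimes\sigma)\circ\Delta|_R$ and $S\circ\sigma|_R=\sigma^{-1}\circ S|_R$; 2. $\Delta(h)=h\otimes r_+r_-+l_+l_-\otimes h$, $\ \varepsilon(h)=0$, and $S(h)=-(l_+l_-r_+r_-)^{-1}h$; 3. $r_\pm$ and $l_\pm$ are grouplike (i.e. $\Delta(x)=x\otimes x$ for $x\in\{r_+,r_-,l_+,l_-\}$), and $\sigma(l_\pm)\otimes\sigma(r_\mp)=\xi\, l_\pm\otimes r_\mp$; 4. $(s_\pm)^{-1}=-l_\pm\sigma^{\pm1}(r_\pm)$. (In each formula the upper signs are taken together, and the lower signs are taken together.)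
   Context: $\mathbb{K}$ is an algebraically closed field of characteristic zero; all algebras are associative unital $\mathbb{K}$-algebras. A Hopf structure on an algebra $B$ is a triple $(\Delta,\varepsilon,S)$ with $\Delta:B\to B\otimes B$ and $\varepsilon:B\to\mathbb{K}$ algebra homomorphisms and $S:B\to B$ an algebra anti-homomorphism, satisfying coassociativity, the counit axiom and the antipode axiom. An element $x$ with $\Delta(x)=x\otimes x$ is called grouplike; in a Hopf algebra the axioms give $\varepsilon(x)=1$, $x$ invertible and $S(x)=x^{-1}$. Let $R$ be a finitely generated commutative $\mathbb{K}$-algebra, $\sigma$ a $\mathbb{K}$-algebra automorphism of $R$, $h\in R$ and $\xi\in\mathbb{K}\setminus\{0\}$. The ambiskew polynomial ring $A(R,\sigma,h,\xi)$ is the associative $\mathbb{K}$-algebra formed by adjoining to $R$ two symbols $X_+,X_-$ subject to $X_\pm a=\sigma^{\pm1}(a)X_\pm$ for $a\in R$ and $X_+X_-=h+\xi X_-X_+$. *)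

(* Defs.v *)
From HB Require Import structures.
From mathcomp Require Import all_boot all_order all_algebra.
From mathcomp Require Import boolp.

Set Implicit Arguments.
Unset Strict Implicit.
Unset Printing Implicit Defensive.

Import GRing.Theory.
Local Open Scope ring_scope.
Local Open Scope quotient_scope.

Reserved Notation "u ⊗ v" (at level 39, left associativity).

(* The library has no tensor product of arbitrary modules.  A list [s] of
   pairs stands for the formal sum of the [p.1 ⊗ p.2], p in s (scalars are
   absorbed in the first components), and formal sums are identified when
   every bilinear map takes the same value on them; the result satisfies the
   universal property of the tensor product, see [tens_liftE], [tens_lift_lin]
   and [tens_ind]. *)
Section FormalSum.
Variables (K : comNzRingType) (U V : lmodType K).

Definition fsum : Type := seq (U * V).

HB.instance Definition _ := Choice.on fsum.

Definition bilin (W : lmodType K) (f : U -> V -> W) :=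
  bilinear_for *:%R *:%R f.

Definition fsum_eval (W : lmodType K) (f : U -> V -> W) (s : fsum) : W :=
  \sum_(p <- s) f p.1 p.2.

Definition fsum_eq (s t : fsum) : bool :=
  `[< forall (W : lmodType K) (f : U -> V -> W),
        bilin f -> fsum_eval f s = fsum_eval f t >].

Lemma fsum_eq_refl : reflexive fsum_eq.
Proof. by move=> s; apply/asboolP. Qed.

Lemma fsum_eq_sym : symmetric fsum_eq.
Proof.
move=> s t; apply/asboolP/asboolP => st W f bf; exact/esym/st.
Qed.

Lemma fsum_eq_trans : transitive fsum_eq.
Proof.
move=> t s u /asboolP st /asboolP tu; apply/asboolP => W f bf.
by rewrite (st W f bf); exact: tu.
Qed.

Canonical fsum_equiv :=
  EquivRel fsum_eq fsum_eq_refl fsum_eq_sym fsum_eq_trans.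

Definition tens : Type := {eq_quot fsum_equiv}.

HB.instance Definition _ := Choice.on tens.
HB.instance Definition _ := EqQuotient.on tens.

Lemma tensP (s t : fsum) :
  (forall (W : lmodType K) (f : U -> V -> W),
     bilin f -> fsum_eval f s = fsum_eval f t) <-> \pi_tens s = \pi_tens t.
Proof.
split=> [st|/eqmodP/asboolP//]; apply/eqmodP; exact/asboolP.
Qed.

Lemma fsum_eval_repr (W : lmodType K) (f : U -> V -> W) (s : fsum) :
  bilin f -> fsum_eval f (repr (\pi_tens s)) = fsum_eval f s.
Proof.
by move=> bf; apply: (proj2 (tensP _ _)) => //; rewrite reprK.
Qed.

Lemma tens_ext (x y : tens) :
  (forall (W : lmodType K) (f : U -> V -> W),
     bilin f -> fsum_eval f (repr x) = fsum_eval f (repr y)) -> x = y.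
Proof. by move/(proj1 (tensP _ _)); rewrite !reprK. Qed.

Lemma bilinDl (W : lmodType K) (f : U -> V -> W) : bilin f ->
  forall u u' v, f (u + u') v = f u v + f u' v.
Proof. by move=> [fl _] u u' v; have := fl v 1 u u'; rewrite /= !scale1r. Qed.

Lemma bilinDr (W : lmodType K) (f : U -> V -> W) : bilin f ->
  forall u v v', f u (v + v') = f u v + f u v'.
Proof. by move=> [_ fr] u v v'; have := fr u 1 v v'; rewrite /= !scale1r. Qed.

Lemma bilin0l (W : lmodType K) (f : U -> V -> W) : bilin f ->
  forall v, f 0 v = 0.
Proof. by move=> bf v; apply: (addIr (f 0 v)); rewrite -bilinDl // !add0r. Qed.

Lemma bilin0r (W : lmodType K) (f : U -> V -> W) : bilin f ->
  forall u, f u 0 = 0.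
Proof. by move=> bf u; apply: (addIr (f u 0)); rewrite -bilinDr // !add0r. Qed.

Lemma bilinZl (W : lmodType K) (f : U -> V -> W) : bilin f ->
  forall c u v, f (c *: u) v = c *: f u v.
Proof.
move=> bf c u v; case: (bf) => fl _; have := fl v c u 0.
by rewrite /= (bilin0l bf) !addr0.
Qed.

Lemma bilinZr (W : lmodType K) (f : U -> V -> W) : bilin f ->
  forall c u v, f u (c *: v) = c *: f u v.
Proof.
move=> bf c u v; case: (bf) => _ fr; have := fr u c v 0.
by rewrite /= (bilin0r bf) !addr0.
Qed.

Definition fsum_scale (c : K) (s : fsum) : fsum :=
  [seq (c *: p.1, p.2) | p <- s].

Lemma fsum_eval_nil (W : lmodType K) (f : U -> V -> W) : fsum_eval f [::] = 0.
Proof. exact: big_nil. Qed.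

Lemma fsum_eval_cat (W : lmodType K) (f : U -> V -> W) (s t : fsum) :
  fsum_eval f (s ++ t) = fsum_eval f s + fsum_eval f t.
Proof. exact: big_cat. Qed.

Lemma fsum_eval_scale (W : lmodType K) (f : U -> V -> W) c (s : fsum) :
  bilin f -> fsum_eval f (fsum_scale c s) = c *: fsum_eval f s.
Proof.
move=> bf; rewrite /fsum_eval big_map scaler_sumr.
by apply: eq_bigr => p _; rewrite bilinZl.
Qed.

Definition pure (u : U) (v : V) : tens := \pi_tens [:: (u, v)].
Definition tens_zero : tens := \pi_tens [::].
Definition tens_add (x y : tens) : tens := \pi_tens (repr x ++ repr y).
Definition tens_scale (c : K) (x : tens) : tens :=
  \pi_tens (fsum_scale c (repr x)).
Definition tens_opp (x : tens) : tens := tens_scale (-1) x.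

Let evalE := (fsum_eval_repr, fsum_eval_cat, fsum_eval_scale, fsum_eval_nil).

Lemma tens_addA : associative tens_add.
Proof. by move=> x y z; apply: tens_ext => W f bf; rewrite !evalE ?addrA. Qed.
Lemma tens_addC : commutative tens_add.
Proof. by move=> x y; apply: tens_ext => W f bf; rewrite !evalE // addrC. Qed.
Lemma tens_add0 : left_id tens_zero tens_add.
Proof. by move=> x; apply: tens_ext => W f bf; rewrite !evalE // add0r. Qed.
Lemma tens_addN : left_inverse tens_zero tens_opp tens_add.
Proof.
by move=> x; apply: tens_ext => W f bf; rewrite !evalE // scaleN1r addNr.
Qed.

HB.instance Definition _ :=
  GRing.isZmodule.Build tens tens_addA tens_addC tens_add0 tens_addN.

Lemma tens_scaleA a b x :
  tens_scale a (tens_scale b x) = tens_scale (a * b) x.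
Proof. by apply: tens_ext => W f bf; rewrite !evalE // scalerA. Qed.
Lemma tens_scale1 : left_id 1 tens_scale.
Proof. by move=> x; apply: tens_ext => W f bf; rewrite !evalE // scale1r. Qed.
Lemma tens_scaleDr : right_distributive tens_scale +%R.
Proof.
by move=> c x y; apply: tens_ext => W f bf; rewrite !evalE // scalerDr.
Qed.
Lemma tens_scaleDl x : {morph tens_scale^~ x : a b / a + b}.
Proof. by move=> a b; apply: tens_ext => W f bf; rewrite !evalE // scalerDl. Qed.

HB.instance Definition _ := GRing.Zmodule_isLmodule.Build K tens
  tens_scaleA tens_scale1 tens_scaleDr tens_scaleDl.

(* Meaningful only for a bilinear [f]. *)
Definition tens_lift (W : lmodType K) (f : U -> V -> W) (x : tens) : W :=
  fsum_eval f (repr x).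

Lemma tens_liftE (W : lmodType K) (f : U -> V -> W) u v :
  bilin f -> tens_lift f (pure u v) = f u v.
Proof.
by move=> bf; rewrite /tens_lift fsum_eval_repr // /fsum_eval big_seq1.
Qed.

Lemma tens_lift_lin (W : lmodType K) (f : U -> V -> W) :
  bilin f -> linear (tens_lift f).
Proof. by move=> bf c x y; rewrite /tens_lift !evalE. Qed.

Lemma pure_bilin : bilin pure.
Proof.
split=> [v c u u'|u c v v']; apply: tens_ext => W f bf;
  rewrite !evalE // /fsum_eval !big_seq1 /=.
- by rewrite bilinDl // bilinZl.
- by rewrite bilinDr // bilinZr.
Qed.

Lemma pi_tensE (s : fsum) : \pi_tens s = \sum_(p <- s) pure p.1 p.2.
Proof.
elim: s => [|p s IHs]; first by rewrite big_nil.
rewrite big_cons -IHs; apply: tens_ext => W f bf.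
by rewrite !evalE // /fsum_eval big_cons big_seq1.
Qed.

Lemma tens_ind (P : tens -> Prop) :
  (forall u v, P (pure u v)) -> P 0 -> (forall x y, P x -> P y -> P (x + y)) ->
  forall x, P x.
Proof.
move=> Pp P0 PD x; rewrite -[x]reprK pi_tensE.
by apply: (big_ind P) => // p _; apply: Pp.
Qed.

End FormalSum.

Arguments tens {K} U V.
Arguments pure_bilin {K} U V.
Notation "u ⊗ v" := (pure u v) : ring_scope.

Section TensorMap.
Variables (K : comNzRingType) (U V U' V' : lmodType K).
Variables (f : {linear U -> U'}) (g : {linear V -> V'}).

Definition tens_map : tens U V -> tens U' V' :=
  tens_lift (fun u v => f u ⊗ g v).

Lemma tens_map_bilin : bilin (fun u v => f u ⊗ g v).
Proof.
split=> [v c u u'|u c v v'] /=; rewrite linearP.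
- by rewrite (bilinDl (pure_bilin _ _)) (bilinZl (pure_bilin _ _)).
- by rewrite (bilinDr (pure_bilin _ _)) (bilinZr (pure_bilin _ _)).
Qed.

Lemma tens_mapE u v : tens_map (u ⊗ v) = f u ⊗ g v.
Proof. exact/tens_liftE/tens_map_bilin. Qed.

Lemma tens_map_linear : linear tens_map.
Proof. exact/tens_lift_lin/tens_map_bilin. Qed.

HB.instance Definition _ := GRing.isLinear.Build K (tens U V) (tens U' V') _
  tens_map tens_map_linear.

End TensorMap.

Section TensorAssoc.
Variables (K : comNzRingType) (U V W : lmodType K).

Definition tens_assoc : tens (tens U V) W -> tens U (tens V W) :=
  tens_lift (fun x w => tens_lift (fun u v => u ⊗ (v ⊗ w)) x).

Lemma tens_assoc_bilin_in (w : W) : bilin (fun (u : U) (v : V) => u ⊗ (v ⊗ w)).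
Proof.
split=> [v c u u'|u c v v'] /=.
- by rewrite (bilinDl (pure_bilin _ _)) (bilinZl (pure_bilin _ _)).
- rewrite (bilinDl (pure_bilin V W)) (bilinZl (pure_bilin V W)).
  by rewrite (bilinDr (pure_bilin _ _)) (bilinZr (pure_bilin _ _)).
Qed.

Lemma tens_assoc_bilin : bilin (fun (x : tens U V) (w : W) =>
  tens_lift (fun u v => u ⊗ (v ⊗ w)) x).
Proof.
split=> [w c x y|x c w w'] /=.
  exact: tens_lift_lin (tens_assoc_bilin_in w) _ _ _.
elim/tens_ind: x => [u v||x y IHx IHy].
- rewrite !tens_liftE; do ?exact: tens_assoc_bilin_in.
  rewrite (bilinDr (pure_bilin V W)) (bilinZr (pure_bilin V W)).
  by rewrite (bilinDr (pure_bilin _ _)) (bilinZr (pure_bilin _ _)).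
- have lift0 (z : W) : tens_lift (fun (u : U) (v : V) => u ⊗ (v ⊗ z)) 0 = 0.
    have := tens_lift_lin (tens_assoc_bilin_in z) (-1) 0 0.
    by rewrite scaleN1r oppr0 addr0 scaleN1r addNr.
  by rewrite !lift0 scaler0 addr0.
- have liftD (z : W) : tens_lift (fun (u : U) (v : V) => u ⊗ (v ⊗ z)) (x + y) =
      tens_lift (fun (u : U) (v : V) => u ⊗ (v ⊗ z)) x +
      tens_lift (fun (u : U) (v : V) => u ⊗ (v ⊗ z)) y.
    have := tens_lift_lin (tens_assoc_bilin_in z) 1 x y.
    by rewrite !scale1r.
  by rewrite !liftD IHx IHy scalerDr addrACA.
Qed.

Lemma tens_assocE u v w : tens_assoc (u ⊗ v ⊗ w) = u ⊗ (v ⊗ w).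
Proof.
rewrite /tens_assoc tens_liftE; last exact: tens_assoc_bilin.
by rewrite tens_liftE //; exact: tens_assoc_bilin_in.
Qed.

Lemma tens_assoc_linear : linear tens_assoc.
Proof. exact/tens_lift_lin/tens_assoc_bilin. Qed.

HB.instance Definition _ := GRing.isLinear.Build K
  (tens (tens U V) W) (tens U (tens V W)) _ tens_assoc tens_assoc_linear.

End TensorAssoc.

(* [tens B C] is given a possibly trivial ring structure because [algType]
   requires [1 != 0]. Together with [tens_scaleAl] and [tens_scaleAr] it is the
   usual algebra B ⊗ C. *)
Section TensorAlgebra.
Variables (K : comNzRingType) (B C : algType K).

Definition fsum_mul (s t : fsum B C) : fsum B C :=
  [seq (p.1 * q.1, p.2 * q.2) | p <- s, q <- t].

Definition tens_mul (x y : tens B C) : tens B C :=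
  \pi_(tens B C) (fsum_mul (repr x) (repr y)).

Lemma fsum_eval_mul (W : lmodType K) (f : B -> C -> W) s t :
  fsum_eval f (fsum_mul s t) =
  \sum_(p <- s) \sum_(q <- t) f (p.1 * q.1) (p.2 * q.2).
Proof. by rewrite /fsum_eval /fsum_mul big_allpairs_dep. Qed.

Lemma mul_bilinl (W : lmodType K) (f : B -> C -> W) (b : B) (c : C) :
  bilin f -> bilin (fun b' c' => f (b * b') (c * c')).
Proof.
move=> bf; split=> [y a x x'|x a y y'] /=; rewrite mulrDr -scalerAr.
- by rewrite bilinDl // bilinZl.
- by rewrite bilinDr // bilinZr.
Qed.

Lemma mul_bilinr (W : lmodType K) (f : B -> C -> W) (b : B) (c : C) :
  bilin f -> bilin (fun b' c' => f (b' * b) (c' * c)).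
Proof.
move=> bf; split=> [y a x x'|x a y y'] /=; rewrite mulrDl -scalerAl.
- by rewrite bilinDl // bilinZl.
- by rewrite bilinDr // bilinZr.
Qed.

Lemma pi_mul s t : \pi_(tens B C) (fsum_mul s t) =
  tens_mul (\pi_(tens B C) s) (\pi_(tens B C) t).
Proof.
apply: (proj1 (tensP _ _)) => W f bf; rewrite !fsum_eval_mul.
transitivity
  (\sum_(p <- s) \sum_(q <- repr (\pi_(tens B C) t)) f (p.1 * q.1) (p.2 * q.2)).
  apply: eq_bigr => p _; have bfp := mul_bilinl p.1 p.2 bf.
  exact/esym/(fsum_eval_repr t bfp).
rewrite exchange_big [RHS]exchange_big /=; apply: eq_bigr => q _.
have bfq := mul_bilinr q.1 q.2 bf; exact/esym/(fsum_eval_repr s bfq).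
Qed.

Lemma pure_mul (b b' : B) (c c' : C) :
  tens_mul (b ⊗ c) (b' ⊗ c') = (b * b') ⊗ (c * c').
Proof. by rewrite /pure -pi_mul. Qed.

Lemma tens_mulDl : left_distributive tens_mul +%R.
Proof.
move=> x y z; rewrite -[x]reprK -[y]reprK -[z]reprK !pi_tensE -big_cat.
rewrite -!pi_tensE -!pi_mul; apply: (proj1 (tensP _ _)) => W f bf.
rewrite fsum_eval_cat !fsum_eval_repr // !fsum_eval_mul.
by rewrite big_cat.
Qed.

Lemma tens_mulDr : right_distributive tens_mul +%R.
Proof.
move=> x y z; rewrite -[x]reprK -[y]reprK -[z]reprK !pi_tensE -big_cat.
rewrite -!pi_tensE -!pi_mul; apply: (proj1 (tensP _ _)) => W f bf.
rewrite fsum_eval_cat !fsum_eval_repr // !fsum_eval_mul.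
by rewrite -big_split /=; apply: eq_bigr => p _; rewrite big_cat.
Qed.

Lemma tens_mul0l x : tens_mul 0 x = 0.
Proof. by apply: (addIr (tens_mul 0 x)); rewrite -tens_mulDl !add0r. Qed.
Lemma tens_mul0r x : tens_mul x 0 = 0.
Proof. by apply: (addIr (tens_mul x 0)); rewrite -tens_mulDr !add0r. Qed.

Lemma tens_mulA : associative tens_mul.
Proof.
move=> x y z; elim/tens_ind: x => [b c||x x' IH IH'].
- elim/tens_ind: y => [b' c'||y y' IH IH'].
  + elim/tens_ind: z => [b'' c''||z z' IH IH'].
    * by rewrite !pure_mul !mulrA.
    * by rewrite !tens_mul0r.
    * by rewrite !tens_mulDr IH IH'.
  + by rewrite !(tens_mul0r, tens_mul0l).
  + by rewrite !(tens_mulDr, tens_mulDl) IH IH'.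
- by rewrite !tens_mul0l.
- by rewrite !tens_mulDl IH IH'.
Qed.

Lemma tens_mul1l : left_id (1 ⊗ 1) tens_mul.
Proof.
elim/tens_ind => [b c||x y IHx IHy].
- by rewrite pure_mul !mul1r.
- exact: tens_mul0r.
- by rewrite tens_mulDr IHx IHy.
Qed.

Lemma tens_mul1r : right_id (1 ⊗ 1) tens_mul.
Proof.
elim/tens_ind => [b c||x y IHx IHy].
- by rewrite pure_mul !mulr1.
- exact: tens_mul0l.
- by rewrite tens_mulDl IHx IHy.
Qed.

HB.instance Definition _ := GRing.Zmodule_isPzRing.Build (tens B C)
  tens_mulA tens_mul1l tens_mul1r tens_mulDl tens_mulDr.

Lemma tens_mulE (b b' : B) (c c' : C) :
  (b ⊗ c) * (b' ⊗ c') = (b * b') ⊗ (c * c').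
Proof. exact: pure_mul. Qed.

Lemma tens_scaleAl (a : K) (x y : tens B C) : a *: (x * y) = (a *: x) * y.
Proof.
elim/tens_ind: x => [b c||x x' IH IH'].
- elim/tens_ind: y => [b' c'||y y' IH IH'].
  + by rewrite -(bilinZl (pure_bilin _ _)) !tens_mulE -scalerAl
       (bilinZl (pure_bilin _ _)).
  + by rewrite !mulr0 scaler0.
  + by rewrite !mulrDr scalerDr IH IH'.
- by rewrite scaler0 !mul0r scaler0.
- by rewrite scalerDr !mulrDl scalerDr IH IH'.
Qed.

Lemma tens_scaleAr (a : K) (x y : tens B C) : a *: (x * y) = x * (a *: y).
Proof.
elim/tens_ind: x => [b c||x x' IH IH'].
- elim/tens_ind: y => [b' c'||y y' IH IH'].
  + by rewrite -(bilinZl (pure_bilin _ _)) !tens_mulE -scalerAr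
       (bilinZl (pure_bilin _ _)).
  + by rewrite scaler0 !mulr0 scaler0.
  + by rewrite scalerDr !mulrDr scalerDr IH IH'.
- by rewrite !mul0r scaler0.
- by rewrite !mulrDl scalerDr IH IH'.
Qed.

End TensorAlgebra.

Section Hopf.
Variables (K : comNzRingType) (B : algType K).

Record hopf_structure := HopfStructure {
  comul : {lrmorphism B -> tens B B};
  counit : {lrmorphism B -> K^o};
  antipode : {linear B -> B};
  antipode1 : antipode 1 = 1;
  antipodeM : forall x y, antipode (x * y) = antipode y * antipode x;
  comul_coassoc : forall x,
    tens_assoc (tens_map comul idfun (comul x)) = tens_map idfun comul (comul x);
  counitl : forall x,
    tens_lift (fun a b : B => (counit a : K) *: b) (comul x) = x;
  counitr : forall x,
    tens_lift (fun a b : B => (counit b : K) *: a) (comul x) = x;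
  antipodel : forall x,
    tens_lift (fun a b : B => antipode a * b) (comul x) = (counit x : K)%:A;
  antipoder : forall x,
    tens_lift (fun a b : B => a * antipode b) (comul x) = (counit x : K)%:A
}.

Definition grouplike (H : hopf_structure) (x : B) := comul H x = x ⊗ x.

End Hopf.

Definition hopf_extends (K : comNzRingType) (B C : algType K)
    (iota : {lrmorphism B -> C}) (HB : hopf_structure B)
    (HC : hopf_structure C) :=
  [/\ forall x, comul HC (iota x) = tens_map iota iota (comul HB x),
      forall x, counit HC (iota x) = counit HB x
    & forall x, antipode HC (iota x) = iota (antipode HB x)].

Definition finitely_generated (K : comNzRingType) (B : algType K) :=
  exists gens : seq B, forall S : {pred B},
    GRing.subalg_closed S -> {subset gens <= S} -> forall x, x \in S.

Record alg_aut (K : comNzRingType) (B : algType K) := AlgAut {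
  aut_fun :> {lrmorphism B -> B};
  aut_inv : B -> B;
  aut_funK : cancel aut_fun aut_inv;
  aut_invK : cancel aut_inv aut_fun
}.

(* The ambiskew polynomial ring by generators and relations: the quotient of
   the K-algebra expressions in the elements of R and two symbols by the least
   congruence containing the K-algebra axioms, the operations of R and the
   defining relations. *)
Section Ambiskew.
Variables (K : comNzRingType) (R : comAlgType K) (sigma : alg_aut R).
Variables (h : R) (xi : K).

Inductive aterm : Type :=
| Abase of R | Aplus | Aminus
| Aadd of aterm & aterm | Amul of aterm & aterm | Ascale of K & aterm.

Inductive acong : aterm -> aterm -> Prop :=
| Acong_refl t : acong t t
| Acong_sym t u : acong t u -> acong u t
| Acong_trans t u v : acong t u -> acong u v -> acong t v
| Acong_add t t' u u' :
    acong t t' -> acong u u' -> acong (Aadd t u) (Aadd t' u')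
| Acong_mul t t' u u' :
    acong t t' -> acong u u' -> acong (Amul t u) (Amul t' u')
| Acong_scale c t t' : acong t t' -> acong (Ascale c t) (Ascale c t')
| Aax_addA t u v : acong (Aadd t (Aadd u v)) (Aadd (Aadd t u) v)
| Aax_addC t u : acong (Aadd t u) (Aadd u t)
| Aax_add0 t : acong (Aadd (Abase 0) t) t
| Aax_addN t : acong (Aadd (Ascale (-1) t) t) (Abase 0)
| Aax_mulA t u v : acong (Amul t (Amul u v)) (Amul (Amul t u) v)
| Aax_mul1l t : acong (Amul (Abase 1) t) t
| Aax_mul1r t : acong (Amul t (Abase 1)) t
| Aax_mulDl t u v : acong (Amul (Aadd t u) v) (Aadd (Amul t v) (Amul u v))
| Aax_mulDr t u v : acong (Amul t (Aadd u v)) (Aadd (Amul t u) (Amul t v))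
| Aax_scaleA c d t : acong (Ascale c (Ascale d t)) (Ascale (c * d) t)
| Aax_scale1 t : acong (Ascale 1 t) t
| Aax_scaleDr c t u :
    acong (Ascale c (Aadd t u)) (Aadd (Ascale c t) (Ascale c u))
| Aax_scaleDl c d t : acong (Ascale (c + d) t) (Aadd (Ascale c t) (Ascale d t))
| Aax_scaleAl c t u : acong (Ascale c (Amul t u)) (Amul (Ascale c t) u)
| Aax_scaleAr c t u : acong (Ascale c (Amul t u)) (Amul t (Ascale c u))
| Abase_add a b : acong (Abase (a + b)) (Aadd (Abase a) (Abase b))
| Abase_mul a b : acong (Abase (a * b)) (Amul (Abase a) (Abase b))
| Abase_scale c a : acong (Abase (c *: a)) (Ascale c (Abase a))
| Arel_plus a :
    acong (Amul Aplus (Abase a)) (Amul (Abase (sigma a)) Aplus)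
| Arel_minus a :
    acong (Amul Aminus (Abase a)) (Amul (Abase (aut_inv sigma a)) Aminus)
| Arel_plus_minus : acong (Amul Aplus Aminus)
    (Aadd (Abase h) (Ascale xi (Amul Aminus Aplus))).

HB.instance Definition _ := gen_eqMixin aterm.
HB.instance Definition _ := gen_choiceMixin aterm.

Definition acongb (t u : aterm) : bool := `[< acong t u >].

Lemma acongb_refl : reflexive acongb.
Proof. by move=> t; apply/asboolP; exact: Acong_refl. Qed.
Lemma acongb_sym : symmetric acongb.
Proof. by move=> t u; apply/asboolP/asboolP; exact: Acong_sym. Qed.
Lemma acongb_trans : transitive acongb.
Proof.
move=> u t v /asboolP tu /asboolP uv; apply/asboolP; exact: Acong_trans uv.
Qed.

Canonical acong_equiv :=
  EquivRel acongb acongb_refl acongb_sym acongb_trans.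

Definition ambiskew : Type := {eq_quot acong_equiv}.

HB.instance Definition _ := Choice.on ambiskew.
HB.instance Definition _ := EqQuotient.on ambiskew.

Lemma ambiskewP t u : acong t u <-> \pi_ambiskew t = \pi_ambiskew u.
Proof. by split=> [tu|/eqmodP/asboolP//]; apply/eqmodP/asboolP. Qed.

Lemma acong_repr t : acong (repr (\pi_ambiskew t)) t.
Proof. by apply/ambiskewP; rewrite reprK. Qed.

Definition ambi_add (x y : ambiskew) : ambiskew :=
  \pi_ambiskew (Aadd (repr x) (repr y)).
Definition ambi_mul (x y : ambiskew) : ambiskew :=
  \pi_ambiskew (Amul (repr x) (repr y)).
Definition ambi_scale (c : K) (x : ambiskew) : ambiskew :=
  \pi_ambiskew (Ascale c (repr x)).
Definition ambi_base (a : R) : ambiskew := \pi_ambiskew (Abase a).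

Lemma pi_ambi_add t u : \pi_ambiskew (Aadd t u) =
  ambi_add (\pi_ambiskew t) (\pi_ambiskew u).
Proof. by apply/ambiskewP/Acong_add; apply/Acong_sym/acong_repr. Qed.
Lemma pi_ambi_mul t u : \pi_ambiskew (Amul t u) =
  ambi_mul (\pi_ambiskew t) (\pi_ambiskew u).
Proof. by apply/ambiskewP/Acong_mul; apply/Acong_sym/acong_repr. Qed.
Lemma pi_ambi_scale c t : \pi_ambiskew (Ascale c t) =
  ambi_scale c (\pi_ambiskew t).
Proof. by apply/ambiskewP/Acong_scale; apply/Acong_sym/acong_repr. Qed.

Let piE := (pi_ambi_add, pi_ambi_mul, pi_ambi_scale).

Lemma ambi_axiom t u : acong t u -> \pi_ambiskew t = \pi_ambiskew u.
Proof. by move/ambiskewP. Qed.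

Lemma ambi_addA : associative ambi_add.
Proof.
by move=> x y z; have := ambi_axiom (Aax_addA (repr x) (repr y) (repr z)); rewrite !piE !reprK.
Qed.
Lemma ambi_addC : commutative ambi_add.
Proof.
by move=> x y; have := ambi_axiom (Aax_addC (repr x) (repr y)); rewrite !piE !reprK.
Qed.
Lemma ambi_add0 : left_id (ambi_base 0) ambi_add.
Proof.
by move=> x; have := ambi_axiom (Aax_add0 (repr x)); rewrite !piE !reprK.
Qed.
Lemma ambi_addN : left_inverse (ambi_base 0) (ambi_scale (-1)) ambi_add.
Proof.
by move=> x; have := ambi_axiom (Aax_addN (repr x)); rewrite !piE !reprK.
Qed.

HB.instance Definition _ :=
  GRing.isZmodule.Build ambiskew ambi_addA ambi_addC ambi_add0 ambi_addN.

Lemma ambi_mulA : associative ambi_mul.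
Proof.
by move=> x y z; have := ambi_axiom (Aax_mulA (repr x) (repr y) (repr z)); rewrite !piE !reprK.
Qed.
Lemma ambi_mul1l : left_id (ambi_base 1) ambi_mul.
Proof.
by move=> x; have := ambi_axiom (Aax_mul1l (repr x)); rewrite !piE !reprK.
Qed.
Lemma ambi_mul1r : right_id (ambi_base 1) ambi_mul.
Proof.
by move=> x; have := ambi_axiom (Aax_mul1r (repr x)); rewrite !piE !reprK.
Qed.
Lemma ambi_mulDl : left_distributive ambi_mul ambi_add.
Proof.
by move=> x y z; have := ambi_axiom (Aax_mulDl (repr x) (repr y) (repr z)); rewrite !piE !reprK.
Qed.
Lemma ambi_mulDr : right_distributive ambi_mul ambi_add.
Proof.
by move=> x y z; have := ambi_axiom (Aax_mulDr (repr x) (repr y) (repr z)); rewrite !piE !reprK.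
Qed.

(* [1 != 0] in the quotient: A acts on the functions nat -> R, with a : R
   acting on the n-th value by sigma^n a, X_- shifting to the right and X_+ to
   the left with the weights below. *)
Fixpoint weight (n : nat) : R :=
  if n is m.+1 then iter n sigma h + xi *: weight m else h.

Fixpoint aterm_act (t : aterm) (f : nat -> R) : nat -> R :=
  match t with
  | Abase a => fun n => iter n sigma a * f n
  | Aplus => fun n => weight n * f n.+1
  | Aminus => fun n => if n is m.+1 then f m else 0
  | Aadd t u => fun n => aterm_act t f n + aterm_act u f n
  | Amul t u => aterm_act t (aterm_act u f)
  | Ascale c t => fun n => c *: aterm_act t f n
  end.

Lemma aterm_act_ext t f g : f =1 g -> aterm_act t f =1 aterm_act t g.
Proof.
elim: t f g => [a|||t IHt u IHu|t IHt u IHu|c t IHt] f g fg n //=.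
- by rewrite fg.
- by rewrite fg.
- by case: n => //= n; rewrite fg.
- by rewrite (IHt f g) // (IHu f g).
- exact/IHt/IHu.
- by rewrite (IHt f g).
Qed.

Lemma aterm_actD t f g n : aterm_act t (fun m => f m + g m) n =
  aterm_act t f n + aterm_act t g n.
Proof.
elim: t f g n => [a|||t IHt u IHu|t IHt u IHu|c t IHt] f g n /=.
- by rewrite mulrDr.
- by rewrite mulrDr.
- by case: n => // ; rewrite addr0.
- by rewrite IHt IHu addrACA.
- by rewrite -IHt; apply: aterm_act_ext => m; exact: IHu.
- by rewrite IHt scalerDr.
Qed.

Lemma aterm_actZ t c f n : aterm_act t (fun m => c *: f m) n =
  c *: aterm_act t f n.
Proof.
elim: t f n => [a|||t IHt u IHu|t IHt u IHu|d t IHt] f n /=.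
- by rewrite scalerAr.
- by rewrite scalerAr.
- by case: n => // ; rewrite scaler0.
- by rewrite IHt IHu scalerDr.
- by rewrite -IHt; apply: aterm_act_ext => m; exact: IHu.
- by rewrite IHt !scalerA mulrC.
Qed.

Lemma iter_sigmaD n : {morph iter n sigma : a b / a + b}.
Proof. by move=> a b; elim: n => //= n ->; rewrite raddfD. Qed.
Lemma iter_sigmaM n : {morph iter n sigma : a b / a * b}.
Proof. by move=> a b; elim: n => //= n ->; rewrite rmorphM. Qed.
Lemma iter_sigmaZ n c : {morph iter n sigma : a / c *: a}.
Proof. by move=> a; elim: n => //= n ->; rewrite linearZ. Qed.
Lemma iter_sigma0 n : iter n sigma 0 = 0.
Proof. by elim: n => //= n ->; rewrite raddf0. Qed.
Lemma iter_sigma1 n : iter n sigma 1 = 1.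
Proof. by elim: n => //= n ->; rewrite rmorph1. Qed.

Lemma acong_act t u : acong t u -> forall f, aterm_act t f =1 aterm_act u f.
Proof.
elim=> {t u}; try by [move=> * n /=; rewrite ?(addrA, scalerA, scale1r)].
- by move=> t u _ tu f n; rewrite tu.
- by move=> t u v _ tu _ uv f n; rewrite tu uv.
- by move=> t t' u u' _ tt' _ uu' f n /=; rewrite tt' uu'.
- move=> t t' u u' _ tt' _ uu' f n /=.
  by rewrite tt'; apply: aterm_act_ext.
- by move=> c t t' _ tt' f n /=; rewrite tt'.
- by move=> t u f n /=; rewrite addrC.
- by move=> t f n /=; rewrite iter_sigma0 mul0r add0r.
- by move=> t f n /=; rewrite iter_sigma0 mul0r scaleN1r addNr.
- by move=> t f n /=; rewrite iter_sigma1 mul1r.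
- move=> t f n /=; apply: aterm_act_ext => m.
  by rewrite iter_sigma1 mul1r.
- by move=> t u v f n /=; rewrite aterm_actD.
- by move=> c t u f n /=; rewrite scalerDr.
- by move=> c d t f n /=; rewrite scalerDl.
- by move=> c t u f n /=; rewrite aterm_actZ.
- by move=> a b f n /=; rewrite iter_sigmaD mulrDl.
- by move=> a b f n /=; rewrite iter_sigmaM mulrA.
- by move=> c a f n /=; rewrite iter_sigmaZ scalerAl.
- by move=> a f n /=; rewrite -iterSr /= mulrCA.
- move=> a f [|n] /=; first by rewrite mulr0.
  by rewrite -iterS iterSr aut_invK.
- move=> f [|n] /=; first by rewrite scaler0 addr0.
  by rewrite mulrDl scalerAl.
Qed.

Lemma ambi_oner_neq0 : ambi_base 1 != 0.
Proof.
apply/eqP => /ambiskewP /acong_act /(_ (fun=> 1) 0%N) /=.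
by rewrite mul1r mul0r; apply/eqP/oner_neq0.
Qed.

HB.instance Definition _ := GRing.Zmodule_isNzRing.Build ambiskew
  ambi_mulA ambi_mul1l ambi_mul1r ambi_mulDl ambi_mulDr ambi_oner_neq0.

Lemma ambi_scaleA c d x : ambi_scale c (ambi_scale d x) = ambi_scale (c * d) x.
Proof.
by have := ambi_axiom (Aax_scaleA c d (repr x)); rewrite !piE !reprK.
Qed.
Lemma ambi_scale1 : left_id 1 ambi_scale.
Proof.
by move=> x; have := ambi_axiom (Aax_scale1 (repr x)); rewrite !piE !reprK.
Qed.
Lemma ambi_scaleDr : right_distributive ambi_scale ambi_add.
Proof.
by move=> c x y; have := ambi_axiom (Aax_scaleDr c (repr x) (repr y)); rewrite !piE !reprK.
Qed.
Lemma ambi_scaleDl x : {morph ambi_scale^~ x : c d / c + d}.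
Proof.
by move=> c d; have := ambi_axiom (Aax_scaleDl c d (repr x)); rewrite !piE !reprK.
Qed.

HB.instance Definition _ := GRing.Zmodule_isLmodule.Build K ambiskew
  ambi_scaleA ambi_scale1 ambi_scaleDr ambi_scaleDl.

Lemma ambi_scaleAl (c : K) (x y : ambiskew) : c *: (x * y) = (c *: x) * y.
Proof.
by have := ambi_axiom (Aax_scaleAl c (repr x) (repr y)); rewrite !piE !reprK.
Qed.

HB.instance Definition _ := GRing.Lmodule_isLalgebra.Build K ambiskew
  ambi_scaleAl.

Lemma ambi_scaleAr (c : K) (x y : ambiskew) : c *: (x * y) = x * (c *: y).
Proof.
by have := ambi_axiom (Aax_scaleAr c (repr x) (repr y)); rewrite !piE !reprK.
Qed.

HB.instance Definition _ := GRing.Lalgebra_isAlgebra.Build K ambiskew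
  ambi_scaleAr.

Lemma ambi_base_linear : linear ambi_base.
Proof.
move=> c a b; have := ambi_axiom (Abase_add (c *: a) b).
by rewrite piE (ambi_axiom (Abase_scale c a)) piE.
Qed.

Lemma ambi_base_monoid : monoid_morphism ambi_base.
Proof.
by split=> // a b; have := ambi_axiom (Abase_mul a b); rewrite piE.
Qed.

HB.instance Definition _ :=
  GRing.isLinear.Build K R ambiskew _ ambi_base ambi_base_linear.
HB.instance Definition _ :=
  GRing.isMonoidMorphism.Build R ambiskew ambi_base ambi_base_monoid.

Definition Xplus : ambiskew := \pi_ambiskew Aplus.
Definition Xminus : ambiskew := \pi_ambiskew Aminus.

Lemma Xplus_base a : Xplus * ambi_base a = ambi_base (sigma a) * Xplus.
Proof.
by have := ambi_axiom (Arel_plus a); rewrite !piE.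
Qed.

Lemma Xminus_base a :
  Xminus * ambi_base a = ambi_base (aut_inv sigma a) * Xminus.
Proof.
by have := ambi_axiom (Arel_minus a); rewrite !piE.
Qed.

Lemma Xplus_Xminus : Xplus * Xminus = ambi_base h + xi *: (Xminus * Xplus).
Proof.
by have := ambi_axiom Arel_plus_minus; rewrite !piE.
Qed.

End Ambiskew.

Arguments ambi_base {K R sigma h xi} a.
Arguments Xplus {K R sigma h xi}.
Arguments Xminus {K R sigma h xi}.

(* Main.v *)
(* In A and A ⊗ A the coefficients of X_+ and X_- over R, resp. R ⊗ R, can be
   read off by linear maps, as 1, X_+ and X_- are independent over R.  Comparing
   coefficients in the Hopf axioms and in the images of the defining relations
   gives necessity: coassociativity makes r and l grouplike, the antipode axiom
   at X determines s, and the relations X a = tau(a) X and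
   X_+ X_- = h + xi X_- X_+ give the rest.  Conversely the same computations
   show that the defining relations are preserved, so that Delta, epsilon and S
   exist by the universal property of A; the Hopf axioms then need only be
   checked on R, X_+ and X_-. *)
Require Import Defs.
From HB Require Import structures.
From mathcomp Require Import all_boot all_order all_algebra.

Set Implicit Arguments.
Unset Strict Implicit.
Unset Printing Implicit Defensive.

Import GRing.Theory.
Local Open Scope ring_scope.

(** * Bilinearity of pure tensors and linearity of lifted maps *)

Section TensorCalculus.
Variables (K : comNzRingType) (U V : lmodType K).

Lemma pureDl (u u' : U) (v : V) : (u + u') ⊗ v = u ⊗ v + u' ⊗ v.
Proof. exact: (bilinDl (pure_bilin U V)). Qed.
Lemma pureDr (u : U) (v v' : V) : u ⊗ (v + v') = u ⊗ v + u ⊗ v'.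
Proof. exact: (bilinDr (pure_bilin U V)). Qed.
Lemma pureZl c (u : U) (v : V) : (c *: u) ⊗ v = c *: (u ⊗ v).
Proof. exact: (bilinZl (pure_bilin U V)). Qed.
Lemma pureZr c (u : U) (v : V) : u ⊗ (c *: v) = c *: (u ⊗ v).
Proof. exact: (bilinZr (pure_bilin U V)). Qed.
Lemma pure0l (v : V) : (0 : U) ⊗ v = 0.
Proof. exact: (bilin0l (pure_bilin U V)). Qed.
Lemma pure0r (u : U) : u ⊗ (0 : V) = 0.
Proof. exact: (bilin0r (pure_bilin U V)). Qed.

Variables (W : lmodType K) (f : U -> V -> W).
Hypothesis bf : bilin f.

Lemma tens_liftD x y : tens_lift f (x + y) = tens_lift f x + tens_lift f y.
Proof. by have := tens_lift_lin bf 1 x y; rewrite !scale1r. Qed.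
Lemma tens_lift0 : tens_lift f 0 = 0.
Proof. by apply: (addIr (tens_lift f 0)); rewrite -tens_liftD !add0r. Qed.
Lemma tens_liftZ c x : tens_lift f (c *: x) = c *: tens_lift f x.
Proof. by have := tens_lift_lin bf c x 0; rewrite tens_lift0 !addr0. Qed.

End TensorCalculus.

Lemma mul_bilin (K : comNzRingType) (B : algType K) : bilin (@GRing.mul B).
Proof.
split=> [v c u u'|u c v v'] /=.
  by rewrite mulrDl scalerAl.
by rewrite mulrDr scalerAr.
Qed.

(** * The inverse of an automorphism as an automorphism *)

Section AutInverse.
Variables (K : comNzRingType) (B : algType K) (sigma : alg_aut B).

Lemma aut_inv_linear : linear (aut_inv sigma).
Proof.
move=> c x y; apply: (can_inj (aut_funK sigma)).
by rewrite linearD linearZ /= !aut_invK.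
Qed.
Lemma aut_inv_monoid : monoid_morphism (aut_inv sigma).
Proof.
split=> [|x y]; apply: (can_inj (aut_funK sigma)).
  by rewrite rmorph1 aut_invK.
by rewrite rmorphM /= !aut_invK.
Qed.
HB.instance Definition _ :=
  GRing.isLinear.Build K B B _ (aut_inv sigma) aut_inv_linear.
HB.instance Definition _ :=
  GRing.isMonoidMorphism.Build B B (aut_inv sigma) aut_inv_monoid.

Definition aut_inverse : alg_aut B :=
  @AlgAut K B (aut_inv sigma) sigma (aut_invK sigma) (aut_funK sigma).

End AutInverse.

(** * Induction principle and universal property of the ambiskew polynomial ring *)

Section Universal.
Variables (K : comNzRingType) (R : comAlgType K) (sigma : alg_aut R).
Variables (h : R) (xi : K).
Local Notation A := (ambiskew sigma h xi).

(** Scaling needs no case of its own: scaling by [c] is multiplication by [ambi_base c%:A]. *)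
Lemma ambiskew_ind (P : A -> Prop) :
  (forall a, P (ambi_base a)) -> P Xplus -> P Xminus ->
  (forall x y, P x -> P y -> P (x + y)) ->
  (forall x y, P x -> P y -> P (x * y)) ->
  forall x, P x.
Proof.
move=> Pb Pp Pm PD PM x; rewrite -[x]reprK; elim: (repr x) => {x}.
- exact: Pb.
- exact: Pp.
- exact: Pm.
- by move=> t Pt u Pu; rewrite pi_ambi_add; apply: PD.
- by move=> t Pt u Pu; rewrite pi_ambi_mul; apply: PM.
move=> c t Pt; rewrite pi_ambi_scale.
have -> : ambi_scale c (\pi_(A)%qT t) = ambi_base c%:A * \pi_(A)%qT t.
  by rewrite linearZ rmorph1 -scalerAl mul1r.
exact: PM.
Qed.

Variables (T : lmodType K) (mul : T -> T -> T) (one : T).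
Hypotheses (mulA : associative mul) (mul1 : left_id one mul)
  (mulr1 : right_id one mul) (mulb : bilin mul).
Variables (f : {linear R -> T}) (xp xm : T).
Hypotheses (f1 : f 1 = one) (fM : forall a b, f (a * b) = mul (f a) (f b)).
Hypotheses (fp : forall a, mul xp (f a) = mul (f (sigma a)) xp)
  (fm : forall a, mul xm (f a) = mul (f (aut_inv sigma a)) xm)
  (fpm : mul xp xm = f h + xi *: mul xm xp).

Fixpoint aterm_eval (t : aterm R) : T :=
  match t with
  | Abase a => f a
  | Aplus => xp
  | Aminus => xm
  | Aadd t u => aterm_eval t + aterm_eval u
  | Amul t u => mul (aterm_eval t) (aterm_eval u)
  | Ascale c t => c *: aterm_eval t
  end.

(** By induction on the congruence: each of its clauses becomes a law of [mul] on [T], a property of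
    [f], or one of [fp], [fm], [fpm]. *)
Lemma aterm_eval_acong t u :
  acong sigma h xi t u -> aterm_eval t = aterm_eval u.
Proof.
elim=> {t u} //=.
- by move=> t u v _ -> _ ->.
- by move=> t t' u u' _ -> _ ->.
- by move=> t t' u u' _ -> _ ->.
- by move=> c t t' _ ->.
- by move=> *; rewrite addrA.
- by move=> *; rewrite addrC.
- by move=> *; rewrite linear0 add0r.
- by move=> *; rewrite linear0 scaleN1r addNr.
- by move=> *; rewrite f1 mul1.
- by move=> *; rewrite f1 mulr1.
- by move=> *; rewrite (bilinDl mulb).
- by move=> *; rewrite (bilinDr mulb).
- by move=> *; rewrite scalerA.
- by move=> *; rewrite scale1r.
- by move=> *; rewrite scalerDr.
- by move=> *; rewrite scalerDl.
- by move=> *; rewrite (bilinZl mulb).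
- by move=> *; rewrite (bilinZr mulb).
- by move=> *; rewrite linearD.
- by move=> *; rewrite linearZ.
Qed.

Let lift (x : A) : T := aterm_eval (repr x).

Let lift_pi t : lift (\pi_(A)%qT t) = aterm_eval t.
Proof. exact/aterm_eval_acong/acong_repr. Qed.

Let lift_linear : linear lift.
Proof.
move=> c x y; rewrite -[x]reprK -[y]reprK -[_ *: _]pi_ambi_scale.
by rewrite -[_ + _]pi_ambi_add !lift_pi.
Qed.

HB.instance Definition _ := GRing.isLinear.Build K A T _ lift lift_linear.

(** The target is a bare module with a bilinear product, so that one statement serves for the
    comultiplication (into A ⊗ A), the counit (into K) and the antipode (into A with the opposite
    product). *)
Lemma ambiskew_lift : exists F : {linear A -> T},
  [/\ forall a, F (ambi_base a) = f a, F Xplus = xp, F Xminus = xm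
    & forall x y, F (x * y) = mul (F x) (F y)].
Proof. by exists lift; split=> *; apply: lift_pi. Qed.

End Universal.

(** * Reading off the coefficients of 1, X_+ and X_- over R *)

Section Projections.
Variables (K : comNzRingType) (R : comAlgType K) (sigma : alg_aut R).
Variables (h : R) (xi : K).
Local Notation A := (ambiskew sigma h xi).

(** The sequence (1, 0, 0, ...) is a vacuum vector: X_+ kills it and X_-^n moves its entry 1 to
    place n. Hence a X_-^n has the value sigma^n(a) at n, and [coord_minus] has to undo one
    [sigma]. *)
Definition ambi_coord (n : nat) (x : A) : R :=
  aterm_act sigma h xi (repr x) (fun n => (n == 0)%:R) n.

Lemma ambi_coord_pi n t : ambi_coord n (\pi_(A)%qT t) =
  aterm_act sigma h xi t (fun n => (n == 0)%:R) n.
Proof. exact/acong_act/acong_repr. Qed.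

Lemma ambi_coord_linear n : linear (ambi_coord n).
Proof.
move=> c x y; rewrite -[x]reprK -[y]reprK -[_ *: _]pi_ambi_scale.
by rewrite -[_ + _]pi_ambi_add !ambi_coord_pi.
Qed.

Definition coord0 : A -> R := ambi_coord 0.
HB.instance Definition _ :=
  GRing.isLinear.Build K A R _ coord0 (ambi_coord_linear 0).

Definition coord_minus (x : A) : R := aut_inv sigma (ambi_coord 1 x).

Lemma coord_minus_linear : linear coord_minus.
Proof.
by move=> c x y; rewrite /coord_minus ambi_coord_linear linearD linearZ.
Qed.
HB.instance Definition _ :=
  GRing.isLinear.Build K A R _ coord_minus coord_minus_linear.

Lemma ambiskew_coord0 : exists p : {linear A -> R},
  [/\ forall a, p (ambi_base a) = a, forall a, p (ambi_base a * Xplus) = 0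
    & forall a, p (ambi_base a * Xminus) = 0].
Proof.
exists coord0; split=> a; rewrite /= /coord0 -?[_ * _]pi_ambi_mul.
- by rewrite ambi_coord_pi /= mulr1.
- by rewrite ambi_coord_pi /= !mulr0.
- by rewrite ambi_coord_pi /= mulr0.
Qed.

Lemma ambiskew_coord_minus : exists p : {linear A -> R},
  [/\ forall a, p (ambi_base a) = 0, forall a, p (ambi_base a * Xplus) = 0
    & forall a, p (ambi_base a * Xminus) = a].
Proof.
exists coord_minus; split=> a; rewrite /= /coord_minus -?[_ * _]pi_ambi_mul.
- by rewrite ambi_coord_pi /= mulr0 linear0.
- by rewrite ambi_coord_pi /= !mulr0 linear0.
- by rewrite ambi_coord_pi /= mulr1 aut_funK.
Qed.

End Projections.

(* The action of [aterm_act] does not see the coefficient of [X_+] when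
   [h = 0]; exchanging [X_+] and [X_-] identifies [A(R, sigma, h, xi)] with
   [A(R, sigma^-1, - xi^-1 h, xi^-1)]. *)
Lemma ambiskew_coord_plus (K : fieldType) (R : comAlgType K)
    (sigma : alg_aut R) (h : R) (xi : K) : xi != 0 ->
  exists p : {linear ambiskew sigma h xi -> R},
  [/\ forall a, p (ambi_base a) = 0, forall a, p (ambi_base a * Xplus) = a
    & forall a, p (ambi_base a * Xminus) = 0].
Proof.
move=> xi_neq0.
pose A' := ambiskew (aut_inverse sigma) (- (xi^-1 *: h)) xi^-1.
have rp a : Xminus * ambi_base a = ambi_base (sigma a) * Xminus :> A'.
  exact: Xminus_base.
have rm a : Xplus * ambi_base a = ambi_base (aut_inv sigma a) * Xplus :> A'.
  exact: Xplus_base.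
have rpm : Xminus * Xplus = ambi_base h + xi *: (Xplus * Xminus) :> A'.
  (* The relation of [A'] is solved for [Xminus * Xplus]; its parameters are chosen to make this the
     relation of the original ring with the generators exchanged. *)
  rewrite Xplus_Xminus scalerDr scalerA mulfV // scale1r.
  by rewrite -linearZ scalerN scalerA mulfV // scale1r rmorphN addNKr.
have [F [Fb Fp Fm FM]] := ambiskew_lift (@mulrA A') (@mul1r A') (@mulr1 A')
  (mul_bilin A') (rmorph1 _) (rmorphM (@ambi_base _ _ _ _ _)) rp rm rpm.
have [p [p0 pp pm]] := ambiskew_coord_minus (aut_inverse sigma)
  (- (xi^-1 *: h)) xi^-1.
exists (p \o F); split=> a /=; rewrite ?FM Fb ?Fp ?Fm.
- exact: p0.
- exact: pm.
- exact: pp.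
Qed.

(** * Contraction of one tensor factor with a linear functional *)

Lemma comp_bilin (K : comNzRingType) (U V U' V' W : lmodType K)
    (F : U' -> V' -> W) (f : {linear U -> U'}) (g : {linear V -> V'}) :
  bilin F -> bilin (fun u v => F (f u) (g v)).
Proof.
move=> bF; split=> [v c u u'|u c v v'] /=; rewrite linearP.
  by rewrite (bilinDl bF) (bilinZl bF).
by rewrite (bilinDr bF) (bilinZr bF).
Qed.

Section Contraction.
Variables (K : comNzRingType) (U V : lmodType K).

Lemma scaler_bilin (phi : {linear U -> K^o}) :
  bilin (fun u v => (phi u : K) *: (v : V)).
Proof.
split=> [v c u u'|u c v v'] /=; rewrite linearP.
  by rewrite scalerDl scalerA.
by [].
Qed.

Lemma scalel_bilin (phi : {linear V -> K^o}) :
  bilin (fun u v => (phi v : K) *: (u : U)).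
Proof.
split=> [v c u u'|u c v v'] /=; rewrite linearP.
  by [].
by rewrite scalerDl scalerA.
Qed.

(** With the counit as [phi] this is the map of the axiom [counitl]; with a coefficient functional
    it isolates the terms of a tensor that have X in the first factor. *)
Definition contractl (phi : {linear U -> K^o}) : tens U V -> V :=
  tens_lift (fun u v => (phi u : K) *: (v : V)).
HB.instance Definition _ phi := GRing.isLinear.Build K (tens U V) V _
  (contractl phi) (tens_lift_lin (scaler_bilin phi)).

Definition contractr (phi : {linear V -> K^o}) : tens U V -> U :=
  tens_lift (fun u v => (phi v : K) *: (u : U)).
HB.instance Definition _ phi := GRing.isLinear.Build K (tens U V) U _
  (contractr phi) (tens_lift_lin (scalel_bilin phi)).

Lemma contractlE phi u v : contractl phi (u ⊗ v) = (phi u : K) *: v.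
Proof. exact: tens_liftE (scaler_bilin phi). Qed.
Lemma contractrE phi u v : contractr phi (u ⊗ v) = (phi v : K) *: u.
Proof. exact: tens_liftE (scalel_bilin phi). Qed.

End Contraction.

Section ContractAssoc.
Variables (K : comNzRingType) (U V W : lmodType K).

(** Here [t] need not be pure: in the coassociativity identity at X it is the coproduct of the
    coefficient l, not yet known to be grouplike. *)
Lemma contractl_assoc (phi : {linear U -> K^o}) (t : tens U V) (w : W) :
  contractl phi (tens_assoc (t ⊗ w)) = contractl phi t ⊗ w.
Proof.
elim/tens_ind: t => [u v||t t' IH IH'].
- by rewrite tens_assocE !contractlE pureZl.
- by rewrite !(linear0, pure0l).
- by rewrite !(linearD, pureDl) /= IH IH'.
Qed.

Lemma contractr_assoc (phi : {linear W -> K^o}) (t : tens U V) (w : W) :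
  tens_map idfun (contractr phi) (tens_assoc (t ⊗ w)) = (phi w : K) *: t.
Proof.
elim/tens_ind: t => [u v||t t' IH IH'].
- by rewrite tens_assocE tens_mapE /= contractrE pureZr.
- by rewrite scaler0 !(linear0, pure0l).
- by rewrite !pureDl !linearD /= IH IH'.
Qed.

End ContractAssoc.

(** * Antipode and counit on grouplike elements *)

Section HopfFacts.
Variables (K : comNzRingType) (B : algType K) (H : hopf_structure B).

Lemma antipode_bilinl : bilin (fun a b : B => antipode H a * b).
Proof. exact: (comp_bilin (antipode H) idfun (mul_bilin B)). Qed.
Lemma antipode_bilinr : bilin (fun a b : B => a * antipode H b).
Proof. exact: (comp_bilin idfun (antipode H) (mul_bilin B)). Qed.

End HopfFacts.

Section Grouplike.
Variables (K : comNzRingType) (R : comUnitAlgType K) (H : hopf_structure R).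

(** The antipode axiom at [g] reads S(g) g = 1. Since [grouplike] also holds for 0, the value of the
    counit is a hypothesis; it comes from [skew_counits] for necessity and from [grouplike_counit]
    for sufficiency. *)
Lemma grouplike_unit (g : R) : grouplike H g -> counit H g = 1 ->
  g \is a GRing.unit /\ antipode H g = g^-1.
Proof.
move=> gg eg; have := antipodel H g.
rewrite gg tens_liftE; last exact: antipode_bilinl.
rewrite eg scale1r => Sgg.
have ug : g \is a GRing.unit.
  by apply/unitrPr; exists (antipode H g); rewrite mulrC.
by split=> //; apply: (mulIr ug); rewrite mulVr.
Qed.

(** The counit axiom gives [counit H g *: g = g]; cancelling the unit [g] and applying the counit
    leaves the claim. *)
Lemma grouplike_counit (g : R) : grouplike H g -> g \is a GRing.unit ->
  counit H g = 1.
Proof.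
move=> gg ug; have := counitl H g.
rewrite gg tens_liftE; last exact: scaler_bilin.
move=> /(congr1 (fun x => counit H (x * g^-1))).
by rewrite -scalerAl mulrV // linearZ /= rmorph1 /GRing.scale /= mulr1.
Qed.

End Grouplike.

(** * Necessary conditions imposed by a single skew-primitive generator *)

Section SkewPrimitiveNecessary.
Variables (K : fieldType) (R : comUnitAlgType K) (A : algType K).
Variables (iota : {lrmorphism R -> A}) (HR : hopf_structure R).
Variables (HA : hopf_structure A) (ext : hopf_extends iota HR HA).
Variables (X : A) (tau : alg_aut R) (r l s : R).
Hypothesis Xiota : forall a, X * iota a = iota (tau a) * X.
Variables (p0 p1 : {linear A -> R}).
Hypotheses (p0iota : forall a, p0 (iota a) = a)
  (p0X : forall a, p0 (iota a * X) = 0)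
  (p1iota : forall a, p1 (iota a) = 0)
  (p1X : forall a, p1 (iota a * X) = a).
Hypotheses (comulX : comul HA X = X ⊗ iota r + iota l ⊗ X)
  (counitX : counit HA X = 0) (antipodeX : antipode HA X = iota s * X).

Let p0X1 : p0 X = 0.
Proof. by rewrite -(p0X 1) rmorph1 mul1r. Qed.
Let p1X1 : p1 X = 1.
Proof. by rewrite -(p1X 1) rmorph1 mul1r. Qed.
Let counit1 : counit HR 1 = 1.
Proof. exact: rmorph1. Qed.

Let tens_iotaK t : tens_map p0 p0 (tens_map iota iota t) = t.
Proof.
elim/tens_ind: t => [a b||t t' IH IH'].
- by rewrite !tens_mapE /= !p0iota.
- by rewrite !linear0.
- by rewrite !linearD /= IH IH'.
Qed.

(** This functional takes the value 1 at [X] and vanishes on the image of [R], so contracting with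
    it selects the terms where [X] sits in the contracted factor. *)
Let eps1 : {linear A -> K^o} := counit HR \o p1.

(** In the coassociativity identity at [X], contracting the first factor with [eps1] leaves r ⊗ r =
    Delta(r), and contracting the third leaves Delta(l) = l ⊗ l; [p0] removes the terms that still
    contain [X]. *)
Lemma skew_grouplikes : grouplike HR r /\ grouplike HR l.
Proof.
have [extD _ _] := ext.
have := comul_coassoc HA X; rewrite comulX !linearD /= !tens_mapE /= !extD.
rewrite comulX !pureDl !pureDr !linearD /= !tens_assocE => coX.
split.
  have /(congr1 (fun t => tens_map p0 p0 (contractl eps1 t))) := coX.
  rewrite !linearD /= contractl_assoc !contractlE ?linearD /= !linearZ /=.
  rewrite !tens_mapE /= tens_iotaK p1X1 p1iota p0X1 !p0iota linear0.
  rewrite counit1 !scale1r !scale0r pure0r ?addr0.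
  by move=> rr; rewrite /grouplike rr.
have := congr1
  (fun t => tens_map p0 p0 (tens_map idfun (contractr eps1) t)) coX.
rewrite !linearD /= contractr_assoc !tens_mapE /= !contractrE.
rewrite !linearZ /= tens_iotaK p1X1 p1iota p0X1 !p0iota linear0.
by rewrite counit1 !scale1r !scale0r ?pure0r ?pure0l ?linear0 ?addr0 ?add0r.
Qed.

(** As the counit kills [X], the two counit axioms at [X] become eps(r) X = X and eps(l) X = X. *)
Lemma skew_counits : counit HR r = 1 /\ counit HR l = 1.
Proof.
have [_ exte _] := ext.
split.
  have := counitr HA X; rewrite comulX.
  rewrite (tens_liftD (scalel_bilin _ _)) !(tens_liftE _ _ (scalel_bilin _ _)).
  rewrite /= exte counitX scale0r addr0 => /(congr1 (counit HR \o p1)) /=.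
  by rewrite !linearZ /= p1X1 counit1 /GRing.scale /= mulr1.
have := counitl HA X; rewrite comulX.
rewrite (tens_liftD (scaler_bilin _ _)) !(tens_liftE _ _ (scaler_bilin _ _)).
rewrite /= exte counitX scale0r add0r => /(congr1 (counit HR \o p1)) /=.
by rewrite !linearZ /= p1X1 counit1 /GRing.scale /= mulr1.
Qed.

(** The antipode axiom at [X] reads (s tau(r) + l^-1) X = 0, whose coefficient gives s tau(r) = -
    l^-1. *)
Lemma skew_antipode_coef : s \is a GRing.unit /\ s^-1 = - (l * tau r).
Proof.
have [_ _ extS] := ext.
have [_ gl] := skew_grouplikes; have [_ el] := skew_counits.
have [ul Sl] := grouplike_unit gl el.
have := antipodel HA X; rewrite comulX.
rewrite (tens_liftD (antipode_bilinl _)) !(tens_liftE _ _ (antipode_bilinl _)).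
rewrite antipodeX counitX scale0r extS Sl -mulrA Xiota mulrA -rmorphM -mulrDl.
rewrite -rmorphD => /(congr1 p1); rewrite p1X linear0 => /eqP.
rewrite addr_eq0 => /eqP slr.
have s1 : s * - (l * tau r) = 1 by rewrite mulrN mulrCA slr mulrN opprK mulrV.
have us : s \is a GRing.unit by apply/unitrPr; exists (- (l * tau r)).
by split=> //; apply: (mulrI us); rewrite mulrV.
Qed.

(** The antipode turns X a = tau(a) X into S(a) s X = s tau(S(tau(a))) X, and the unit [s]
    cancels. *)
Lemma skew_antipode_aut a : antipode HR (tau a) = aut_inv tau (antipode HR a).
Proof.
have [us _] := skew_antipode_coef; have [_ _ extS] := ext.
have := antipodeM HA X (iota a); rewrite Xiota antipodeM !extS antipodeX.
rewrite -mulrA Xiota !mulrA -!rmorphM => /(congr1 p1); rewrite !p1X.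
by rewrite [RHS]mulrC => /(mulrI us) <-; rewrite aut_funK.
Qed.

(** Delta is applied to X a = tau(a) X. The terms with [X] in the first factor give one identity
    after cancelling [r], those with [X] in the second give the other after cancelling [l]. *)
Lemma skew_comul_aut a :
  tens_map tau idfun (comul HR a) = comul HR (tau a) /\
  comul HR (tau a) = tens_map idfun tau (comul HR a).
Proof.
have [extD _ _] := ext.
have [gr gl] := skew_grouplikes; have [er el] := skew_counits.
have [ur _] := grouplike_unit gr er; have [ul _] := grouplike_unit gl el.
have coXa : tens_map iota iota (comul HR (tau a)) * (X ⊗ iota r + iota l ⊗ X)
    = (X ⊗ iota r + iota l ⊗ X) * tens_map iota iota (comul HR a).
  by rewrite -!extD -comulX -!rmorphM Xiota.
(* Coefficients with [X] in the first factor only: [iota l ⊗ X] contributes nothing, because [p1]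
   vanishes on the image of [R]. *)
have p10 t : [/\ tens_map p1 p0 ((X ⊗ iota r) * tens_map iota iota t) =
                 tens_map tau idfun t * (1 ⊗ r),
    tens_map p1 p0 (tens_map iota iota t * (X ⊗ iota r)) = t * (1 ⊗ r),
    tens_map p1 p0 ((iota l ⊗ X) * tens_map iota iota t) = 0 &
    tens_map p1 p0 (tens_map iota iota t * (iota l ⊗ X)) = 0].
  elim/tens_ind: t => [b c||t t' [e1 e2 e3 e4] [e1' e2' e3' e4']].
  - rewrite !tens_mapE !tens_mulE !tens_mapE /=.
    rewrite !Xiota -!rmorphM !(p1X, p1iota, p0iota) !pure0l !mulr1.
    by rewrite (mulrC r).
  - by rewrite !(linear0, mul0r, mulr0).
  - by rewrite !(linearD, mulrDl, mulrDr) /= e1 e2 e3 e4 e1' e2' e3' e4' addr0.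
have p01 t : [/\ tens_map p0 p1 ((iota l ⊗ X) * tens_map iota iota t) =
                 tens_map idfun tau t * (l ⊗ 1),
    tens_map p0 p1 (tens_map iota iota t * (iota l ⊗ X)) = t * (l ⊗ 1),
    tens_map p0 p1 ((X ⊗ iota r) * tens_map iota iota t) = 0 &
    tens_map p0 p1 (tens_map iota iota t * (X ⊗ iota r)) = 0].
  elim/tens_ind: t => [b c||t t' [e1 e2 e3 e4] [e1' e2' e3' e4']].
  - rewrite !tens_mapE !tens_mulE !tens_mapE /=.
    rewrite !Xiota -!rmorphM !(p1X, p1iota, p0iota) !pure0r !mulr1.
    by rewrite (mulrC l).
  - by rewrite !(linear0, mul0r, mulr0).
  - by rewrite !(linearD, mulrDl, mulrDr) /= e1 e2 e3 e4 e1' e2' e3' e4' addr0.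
split.
  have := congr1 (fun t => tens_map p1 p0 t * (1 ⊗ r^-1)) coXa.
  rewrite mulrDl mulrDr !linearD /=.
  have [_ -> _ ->] := p10 (comul HR (tau a)).
  have [-> _ -> _] := p10 (comul HR a).
  by rewrite !addr0 -!mulrA !tens_mulE !mulr1 mulrV // !mulr1.
have := congr1 (fun t => tens_map p0 p1 t * (l^-1 ⊗ 1)) coXa.
rewrite mulrDl mulrDr !linearD /=.
have [_ -> _ ->] := p01 (comul HR (tau a)).
have [-> _ -> _] := p01 (comul HR a).
by rewrite !add0r -!mulrA !tens_mulE !mulr1 mulrV // !mulr1.
Qed.

End SkewPrimitiveNecessary.

(** * The relation between X_+ and X_- under comultiplication *)

Section RelationComul.
Variables (K : comNzRingType) (R : comAlgType K) (sigma : alg_aut R).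
Variables (h : R) (xi : K).
Local Notation A := (ambiskew sigma h xi).
Local Notation ib := (@ambi_base K R sigma h xi).
Variables (rp rm lp lm : R).

(** This normal form serves both directions. Products with both generators in one tensor factor
    collapse to [h] by the defining relation; those with one generator in each factor survive and
    must cancel pairwise, which is the content of condition 3. *)
Lemma skew_relation_comul :
  (Xplus ⊗ ib rp + ib lp ⊗ Xplus) * (Xminus ⊗ ib rm + ib lm ⊗ Xminus) -
  xi *: ((Xminus ⊗ ib rm + ib lm ⊗ Xminus) * (Xplus ⊗ ib rp + ib lp ⊗ Xplus)) =
  ib h ⊗ ib (rp * rm) + ib (lp * lm) ⊗ ib h
  + ((ib (sigma lm) * Xplus) ⊗ (ib rp * Xminus) -
     xi *: ((ib lm * Xplus) ⊗ (ib (aut_inv sigma rp) * Xminus)))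
  + ((ib lp * Xminus) ⊗ (ib (sigma rm) * Xplus) -
     xi *: ((ib (aut_inv sigma lp) * Xminus) ⊗ (ib rm * Xplus))) :> tens A A.
Proof.
(* [x1] and [x2] stand for the terms with [Xminus * Xplus] in one factor, which cancel. *)
have regroup (V : zmodType) (y1 x1 a b y2 x2 c d : V) :
    y1 + x1 + a + (b + (y2 + x2)) - (x1 + d + (c + x2)) =
    y1 + y2 + (a - c) + (b - d).
  rewrite !opprD !addrA.
  rewrite [LHS](ACl (1*5*(3*9)*(4*8)*(2*7)*(6*10))%AC) /=.
  by rewrite !subrr !addr0 !addrA.
rewrite !mulrDl !mulrDr !tens_mulE !Xplus_base !Xminus_base Xplus_Xminus.
rewrite pureDl pureDr pureZl pureZr -!rmorphM (mulrC rm) (mulrC lm).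
by rewrite !scalerDr regroup.
Qed.

End RelationComul.

(** * Necessity of the four conditions *)

Section Necessity.
Variables (K : fieldType) (R : comUnitAlgType K) (sigma : alg_aut R).
Variables (h : R) (xi : K) (xi_neq0 : xi != 0).
Local Notation A := (ambiskew sigma h xi).
Variables (HR : hopf_structure R) (HA : hopf_structure A).
Variables (rp rm lp lm sp sm : R).
Hypothesis ext : hopf_extends ambi_base HR HA.
Hypotheses
  (comulp : comul HA Xplus = Xplus ⊗ ambi_base rp + ambi_base lp ⊗ Xplus)
  (comulm : comul HA Xminus = Xminus ⊗ ambi_base rm + ambi_base lm ⊗ Xminus)
  (counitp : counit HA Xplus = 0) (counitm : counit HA Xminus = 0)
  (antip : antipode HA Xplus = ambi_base sp * Xplus)
  (antim : antipode HA Xminus = ambi_base sm * Xminus).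

(** The single-generator results are used with [sigma] for [Xplus] and with [aut_inverse sigma] for
    [Xminus]; the identities for [sigma] are read off from [Xplus]. *)
Lemma hopf_extension_skew :
  [/\ [/\ forall a, tens_map sigma idfun (comul HR a) = comul HR (sigma a),
          forall a, comul HR (sigma a) = tens_map idfun sigma (comul HR a)
        & forall a, antipode HR (sigma a) = aut_inv sigma (antipode HR a)],
      [/\ grouplike HR rp, grouplike HR rm, grouplike HR lp & grouplike HR lm],
      [/\ counit HR rp = 1, counit HR rm = 1, counit HR lp = 1
        & counit HR lm = 1] &
      [/\ sp \is a GRing.unit, sp^-1 = - (lp * sigma rp),
          sm \is a GRing.unit & sm^-1 = - (lm * aut_inv sigma rm)]].
Proof.
have [p0 [p0b p0p p0m]] := ambiskew_coord0 sigma h xi.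
have [pp [ppb ppp ppm]] := ambiskew_coord_plus sigma h xi_neq0.
have [pm [pmb pmp pmm]] := ambiskew_coord_minus sigma h xi.
have Xp a : Xplus * ambi_base a = ambi_base (sigma a) * Xplus :> A.
  exact: Xplus_base.
have Xm a :
    Xminus * ambi_base a = ambi_base (aut_inverse sigma a) * Xminus :> A.
  exact: Xminus_base.
have [grp glp] := skew_grouplikes ext p0b p0p ppb ppp comulp.
have [grm glm] := skew_grouplikes ext p0b p0m pmb pmm comulm.
have [erp elp] := skew_counits ext ppp comulp counitp.
have [erm elm] := skew_counits ext pmm comulm counitm.
have [usp spE] :=
  skew_antipode_coef ext Xp p0b p0p ppb ppp comulp counitp antip.
have [usm smE] :=
  skew_antipode_coef ext Xm p0b p0m pmb pmm comulm counitm antim.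
have skD a := skew_comul_aut ext Xp p0b p0p ppb ppp comulp counitp a.
have skS a := skew_antipode_aut ext Xp p0b p0p ppb ppp comulp counitp antip a.
by split=> //; split=> // a; have [] := skD a.
Qed.

(** Delta and epsilon are applied to h = X_+ X_- - xi X_- X_+, and the coefficients of 1 ⊗ 1, X_- ⊗
    X_+ and X_+ ⊗ X_- are compared in the coproduct. *)
Lemma hopf_extension_relation :
  [/\ comul HR h = h ⊗ (rp * rm) + (lp * lm) ⊗ h, counit HR h = 0,
      sigma lp ⊗ sigma rm = xi *: (lp ⊗ rm)
    & sigma lm ⊗ sigma rp = xi *: (lm ⊗ rp)].
Proof.
have [p0 [p0b p0p p0m]] := ambiskew_coord0 sigma h xi.
have [pp [ppb ppp ppm]] := ambiskew_coord_plus sigma h xi_neq0.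
have [pm [pmb pmp pmm]] := ambiskew_coord_minus sigma h xi.
have [extD exte _] := ext.
have hE : ambi_base h = Xplus * Xminus - xi *: (Xminus * Xplus) :> A.
  by rewrite Xplus_Xminus addrK.
have coh : tens_map ambi_base ambi_base (comul HR h) =
    comul HA Xplus * comul HA Xminus - xi *: (comul HA Xminus * comul HA Xplus).
  by rewrite -extD /= hE raddfB /= linearZ !rmorphM.
rewrite comulp comulm skew_relation_comul in coh.
have pushF (V W : lmodType K) (F : {linear V -> W}) a b c d e f :
    F (a + b + (c - xi *: d) + (e - xi *: f)) =
    F a + F b + (F c - xi *: F d) + (F e - xi *: F f).
  by rewrite !linearD !linearN !linearZ.
have p00 t : tens_map p0 p0 (tens_map ambi_base ambi_base t) = t.
  elim/tens_ind: t => [a b||t t' IH IH'].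
  - by rewrite !tens_mapE /= !p0b.
  - by rewrite !linear0.
  - by rewrite !linearD /= IH IH'.
have p10 (p q : {linear A -> R}) : (forall a, p (ambi_base a) = 0) ->
    tens_map p q (tens_map ambi_base ambi_base (comul HR h)) = 0.
  move=> pb; elim/tens_ind: (comul HR h) => [a b||t t' IH IH'].
  - by rewrite !tens_mapE /= pb pure0l.
  - by rewrite !linear0.
  - by rewrite !linearD /= IH IH' addr0.
split.
- have := congr1 (tens_map p0 p0) coh.
  rewrite p00 pushF /= !tens_mapE /=.
  by rewrite !p0b !(p0p, p0m) !pure0l !(scaler0, subrr) !addr0.
- rewrite -exte /= hE raddfB /= linearZ !rmorphM.
  by rewrite /= counitp mul0r mulr0 scaler0 subrr.
(* This coefficient yields lp ⊗ sigma(rm) = xi sigma^-1(lp) ⊗ rm; applying [sigma] to the first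
   factor gives the symmetric form. *)
- have := congr1 (tens_map pm pp) coh.
  rewrite p10 // pushF /= !tens_mapE /=.
  rewrite !(pmb, pmp, pmm, ppb, ppm, ppp) !(pure0l, pure0r).
  rewrite !(scaler0, oppr0, addr0, add0r) => /esym/eqP.
  rewrite subr_eq0 => /eqP /(congr1 (tens_map sigma idfun)).
  by rewrite linearZ /= !tens_mapE /= aut_invK.
have := congr1 (tens_map pp pm) coh.
rewrite p10 // pushF /= !tens_mapE /=.
rewrite !(pmb, pmp, pmm, ppb, ppm, ppp) !(pure0l, pure0r).
rewrite !(scaler0, oppr0, addr0, add0r) => /esym/eqP.
rewrite subr_eq0 => /eqP /(congr1 (tens_map idfun sigma)).
by rewrite linearZ /= !tens_mapE /= aut_invK.
Qed.

(** The antipode axiom at [h] reads S(h) rp rm + (lp lm)^-1 h = 0. *)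
Lemma hopf_extension_antipode :
  lp * lm * rp * rm \is a GRing.unit /\
  antipode HR h = - (lp * lm * rp * rm)^-1 * h.
Proof.
have [_ [grp grm glp glm] [erp erm elp elm] _] := hopf_extension_skew.
have [coh eh _ _] := hopf_extension_relation.
have [urp Srp] := grouplike_unit grp erp.
have [urm Srm] := grouplike_unit grm erm.
have [ulp Slp] := grouplike_unit glp elp.
have [ulm Slm] := grouplike_unit glm elm.
have ul : lp * lm \is a GRing.unit by rewrite unitrM ulp.
have ur : rp * rm \is a GRing.unit by rewrite unitrM urp.
split; first by rewrite -mulrA unitrM ul.
have := antipodel HR h; rewrite coh.
rewrite (tens_liftD (antipode_bilinl _)) !(tens_liftE _ _ (antipode_bilinl _)).
rewrite eh scale0r antipodeM Slp Slm -invrM // => /eqP.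
rewrite addr_eq0 => /eqP Sh; apply: (mulIr ur).
rewrite -[lp * lm * rp * rm]mulrA invrM // Sh !mulNr [in RHS]mulrC.
by rewrite -[_^-1 * _ * _]mulrA mulVKr // invrM.
Qed.

End Necessity.

(** * Products on tensor products and multiplicativity of maps between them *)

Lemma tens_bilin_ext (K : comNzRingType) (U V U' V' W : lmodType K)
    (F G : tens U V -> tens U' V' -> W) : bilin F -> bilin G ->
  (forall u v u' v', F (u ⊗ v) (u' ⊗ v') = G (u ⊗ v) (u' ⊗ v')) ->
  forall x y, F x y = G x y.
Proof.
move=> bF bG FG x y; elim/tens_ind: x => [u v||x x' IH IH'].
- elim/tens_ind: y => [u' v'||y y' IH IH']; first exact: FG.
    by rewrite (bilin0r bF) (bilin0r bG).
  by rewrite (bilinDr bF) (bilinDr bG) IH IH'.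
- by rewrite (bilin0l bF) (bilin0l bG).
- by rewrite (bilinDl bF) (bilinDl bG) IH IH'.
Qed.

Lemma linear_bilin (K : comNzRingType) (U V W W' : lmodType K)
    (g : {linear W -> W'}) (F : U -> V -> W) :
  bilin F -> bilin (fun u v => g (F u v)).
Proof.
move=> bF; split=> [v c u u'|u c v v'] /=.
  by rewrite (bilinDl bF) (bilinZl bF) linearP.
by rewrite (bilinDr bF) (bilinZr bF) linearP.
Qed.

Lemma tens_mul_bilin (K : comNzRingType) (B C : algType K) :
  bilin (@GRing.mul (tens B C)).
Proof.
split=> [v c u u'|u c v v'] /=.
  by rewrite mulrDl tens_scaleAl.
by rewrite mulrDr tens_scaleAr.
Qed.

(* [tens (tens B B) B] carries no ring structure since [tens B B] is not an
   [algType]; [tens_op] is the product that it should have. *)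
Section TensOp.
Variables (K : comNzRingType) (U V : lmodType K).
Variables (mU : U -> U -> U) (mV : V -> V -> V).
Hypotheses (bU : bilin mU) (bV : bilin mV).

Definition tens_op (x y : tens U V) : tens U V :=
  tens_lift (fun u v => tens_lift (fun u' v' => mU u u' ⊗ mV v v') y) x.

Let op_in u v : bilin (fun u' v' => mU u u' ⊗ mV v v').
Proof.
split=> [v' c u1 u2|u' c v1 v2] /=.
  by rewrite (bilinDr bU) (bilinZr bU) pureDl pureZl.
by rewrite (bilinDr bV) (bilinZr bV) pureDr pureZr.
Qed.

Let op_out y :
  bilin (fun u v => tens_lift (fun u' v' => mU u u' ⊗ mV v v') y).
Proof.
split=> [v c u1 u2|u c v1 v2] /=; rewrite /tens_lift /fsum_eval scaler_sumr.
  rewrite -big_split; apply: eq_bigr => p _.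
  by rewrite (bilinDl bU) (bilinZl bU) pureDl pureZl.
rewrite -big_split; apply: eq_bigr => p _.
by rewrite (bilinDl bV) (bilinZl bV) pureDr pureZr.
Qed.

Lemma tens_opE u v u' v' : tens_op (u ⊗ v) (u' ⊗ v') = mU u u' ⊗ mV v v'.
Proof.
by rewrite /tens_op (tens_liftE _ _ (op_out _)) (tens_liftE _ _ (op_in _ _)).
Qed.

Lemma tens_op_bilin : bilin tens_op.
Proof.
split=> [y|x]; first exact: tens_lift_lin (op_out y).
move=> c y y' /=; rewrite /tens_op; elim/tens_ind: x => [u v||x x' IH IH'].
- by rewrite !(tens_liftE _ _ (op_out _)); apply: tens_lift_lin (op_in _ _) _ _ _.
- by rewrite !(tens_lift0 (op_out _)) scaler0 addr0.
- by rewrite !(tens_liftD (op_out _)) IH IH' scalerDr addrACA.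
Qed.

End TensOp.

Lemma tens_op_mul (K : comNzRingType) (B C : algType K) (x y : tens B C) :
  tens_op *%R *%R x y = x * y.
Proof.
have bB := mul_bilin B; have bC := mul_bilin C.
apply: (tens_bilin_ext (tens_op_bilin bB bC) (tens_mul_bilin B C)) => b c b' c'.
by rewrite tens_opE // tens_mulE.
Qed.

(** The targets carry arbitrary bilinear products so that the lemma covers Delta ⊗ id and id ⊗
    Delta, whose values lie in triple tensor products. *)
Lemma tens_map_op (K : comNzRingType) (B C : algType K) (U V : lmodType K)
    (mU : U -> U -> U) (mV : V -> V -> V)
    (f : {linear B -> U}) (g : {linear C -> V}) :
  bilin mU -> bilin mV ->
  (forall x y, f (x * y) = mU (f x) (f y)) ->
  (forall x y, g (x * y) = mV (g x) (g y)) ->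
  forall x y,
    tens_map f g (x * y) = tens_op mU mV (tens_map f g x) (tens_map f g y).
Proof.
move=> bU bV fM gM; apply: tens_bilin_ext => [||b c b' c'].
- exact: linear_bilin (tens_mul_bilin B C).
- exact: (comp_bilin (tens_map f g) (tens_map f g) (tens_op_bilin bU bV)).
by rewrite tens_mulE !tens_mapE fM gM tens_opE.
Qed.

Lemma tens_mapM (K : comNzRingType) (B C B' C' : algType K)
    (f : {lrmorphism B -> B'}) (g : {lrmorphism C -> C'}) x y :
  tens_map f g (x * y) = tens_map f g x * tens_map f g y.
Proof.
rewrite -(tens_op_mul (tens_map f g x)).
by rewrite -(tens_map_op (mul_bilin B') (mul_bilin C')) // => *; apply: rmorphM.
Qed.

Lemma tens_assoc_op (K : comNzRingType) (B C D : algType K)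
    (x y : tens (tens B C) D) :
  tens_assoc (tens_op (U := tens B C) *%R *%R x y) =
  tens_op (V := tens C D) *%R *%R (tens_assoc x) (tens_assoc y).
Proof.
have bB := mul_bilin B; have bD := mul_bilin D.
have bBC := tens_mul_bilin B C; have bCD := tens_mul_bilin C D.
have b1 := linear_bilin (@tens_assoc K B C D) (tens_op_bilin bBC bD).
have b2 := comp_bilin (@tens_assoc K B C D) (@tens_assoc K B C D)
  (tens_op_bilin bB bCD).
apply: (tens_bilin_ext b1 b2) => {x y} u d u' d' /=; rewrite tens_opE //.
elim/tens_ind: u => [b c||t t' IH IH'].
- elim/tens_ind: u' => [b' c'||t t' IH IH'].
  + by rewrite tens_mulE !tens_assocE tens_opE // tens_mulE.
  + by rewrite mulr0 !pure0l !linear0 (bilin0r (tens_op_bilin bB bCD)).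
  + rewrite mulrDr !pureDl !linearD /= IH IH'.
    by rewrite (bilinDr (tens_op_bilin bB bCD)).
- by rewrite mul0r !pure0l !linear0 (bilin0l (tens_op_bilin bB bCD)).
rewrite mulrDl !pureDl !linearD /= IH IH'.
by rewrite (bilinDl (tens_op_bilin bB bCD)).
Qed.

(* Each Hopf axiom holds on a subalgebra, hence everywhere once it holds on
   generators. *)
Section HopfAxiomsAt.
Variables (K : comNzRingType) (B : algType K).
Variables (D : {lrmorphism B -> tens B B}) (E : {lrmorphism B -> K^o}).
Variables (S : {linear B -> B}).
Hypothesis SM : forall x y, S (x * y) = S y * S x.

Lemma coassocM x y :
  tens_assoc (tens_map D idfun (D x)) = tens_map idfun D (D x) ->
  tens_assoc (tens_map D idfun (D y)) = tens_map idfun D (D y) ->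
  tens_assoc (tens_map D idfun (D (x * y))) = tens_map idfun D (D (x * y)).
Proof.
move=> ex ey; have bB := mul_bilin B; have bBB := tens_mul_bilin B B.
have DM a b : D (a * b) = D a * D b by exact: rmorphM.
have idM (a b : B) : idfun (a * b) = idfun a * idfun b by [].
rewrite DM (tens_map_op bBB bB DM idM) (tens_map_op bB bBB idM DM).
by rewrite tens_assoc_op ex ey.
Qed.

Lemma counitlM x y :
  contractl E (D x) = x -> contractl E (D y) = y ->
  contractl E (D (x * y)) = x * y.
Proof.
move=> ex ey; rewrite rmorphM -[in RHS]ex -[in RHS]ey.
apply: (tens_bilin_ext (F := fun u v => contractl E (u * v))
  (G := fun u v => contractl E u * contractl E v)).
- exact: linear_bilin (tens_mul_bilin B B).
- exact: (comp_bilin (contractl E) (contractl E) (mul_bilin B)).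
move=> a b a' b'; rewrite tens_mulE !contractlE /= rmorphM.
by rewrite -scalerAl -scalerAr scalerA.
Qed.

Lemma counitrM x y :
  contractr E (D x) = x -> contractr E (D y) = y ->
  contractr E (D (x * y)) = x * y.
Proof.
move=> ex ey; rewrite rmorphM -[in RHS]ex -[in RHS]ey.
apply: (tens_bilin_ext (F := fun u v => contractr E (u * v))
  (G := fun u v => contractr E u * contractr E v)).
- exact: linear_bilin (tens_mul_bilin B B).
- exact: (comp_bilin (contractr E) (contractr E) (mul_bilin B)).
move=> a b a' b'; rewrite tens_mulE !contractrE /= rmorphM.
by rewrite -scalerAl -scalerAr scalerA.
Qed.

Let Sl := fun a b : B => S a * b.
Let Sr := fun a b : B => a * S b.
Let bSl : bilin Sl. Proof. exact: (comp_bilin S idfun (mul_bilin B)). Qed.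
Let bSr : bilin Sr. Proof. exact: (comp_bilin idfun S (mul_bilin B)). Qed.

(** In Sweedler notation the left side is S(y1) S(x1) x2 y2. The inner sum over [D x] collapses to
    the scalar [E x], so the outer induction runs over [D y]. *)
Lemma antipodelM x y :
  tens_lift Sl (D x) = (E x : K)%:A -> tens_lift Sl (D y) = (E y : K)%:A ->
  tens_lift Sl (D (x * y)) = (E (x * y) : K)%:A.
Proof.
move=> ex ey; rewrite !rmorphM /= -scalerA -ey.
elim/tens_ind: (D y) => [b c||t t' IH IH'].
- transitivity (S b * tens_lift Sl (D x) * c).
    elim/tens_ind: (D x) => [b' c'||t t' IH IH'].
    + by rewrite tens_mulE !tens_liftE // /Sl SM !mulrA.
    + by rewrite mul0r !tens_lift0 // mulr0 mul0r.
    + by rewrite mulrDl !tens_liftD // IH IH' mulrDr mulrDl.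
  by rewrite ex tens_liftE // -scalerAr mulr1 -scalerAl.
- by rewrite mulr0 tens_lift0 // scaler0.
- by rewrite mulrDr !tens_liftD // IH IH' scalerDr.
Qed.

(** Now the sum is x1 y1 S(y2) S(x2), with [D y] inside, so the roles of [x] and [y] are
    exchanged. *)
Lemma antipoderM x y :
  tens_lift Sr (D x) = (E x : K)%:A -> tens_lift Sr (D y) = (E y : K)%:A ->
  tens_lift Sr (D (x * y)) = (E (x * y) : K)%:A.
Proof.
move=> ex ey; rewrite !rmorphM /= mulrC -scalerA -ex.
elim/tens_ind: (D x) => [b c||t t' IH IH'].
- transitivity (b * tens_lift Sr (D y) * S c).
    elim/tens_ind: (D y) => [b' c'||t t' IH IH'].
    + by rewrite tens_mulE !tens_liftE // /Sr SM !mulrA.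
    + by rewrite mulr0 !tens_lift0 // mulr0 mul0r.
    + by rewrite mulrDr !tens_liftD // IH IH' mulrDr mulrDl.
  by rewrite ey tens_liftE // -scalerAr mulr1 -scalerAl.
- by rewrite mul0r tens_lift0 // scaler0.
- by rewrite mulrDl !tens_liftD // IH IH' scalerDr.
Qed.

Definition hopf_axioms_at (x : B) :=
  [/\ tens_assoc (tens_map D idfun (D x)) = tens_map idfun D (D x),
      contractl E (D x) = x, contractr E (D x) = x,
      tens_lift Sl (D x) = (E x : K)%:A
    & tens_lift Sr (D x) = (E x : K)%:A].

Lemma hopf_axiomsM x y :
  hopf_axioms_at x -> hopf_axioms_at y -> hopf_axioms_at (x * y).
Proof.
move=> [x1 x2 x3 x4 x5] [y1 y2 y3 y4 y5]; split.
- exact: coassocM.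
- exact: counitlM.
- exact: counitrM.
- exact: antipodelM.
- exact: antipoderM.
Qed.

Lemma hopf_axiomsD x y :
  hopf_axioms_at x -> hopf_axioms_at y -> hopf_axioms_at (x + y).
Proof.
move=> [x1 x2 x3 x4 x5] [y1 y2 y3 y4 y5]; split.
- by rewrite !linearD /= x1 y1.
- by rewrite !linearD /= x2 y2.
- by rewrite !linearD /= x3 y3.
- by rewrite !linearD tens_liftD // x4 y4 /= scalerDl.
- by rewrite !linearD tens_liftD // x5 y5 /= scalerDl.
Qed.

(** Coassociativity and the counit axioms follow from the grouplikes [g] and [k]; the two antipode
    axioms remain as equations, to be settled by the choice of the antipode at [x]. *)
Lemma hopf_axioms_skew x g k :
  D x = x ⊗ g + k ⊗ x -> D g = g ⊗ g -> D k = k ⊗ k ->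
  E x = 0 -> E g = 1 -> E k = 1 ->
  S x * g + S k * x = 0 -> x * S g + k * S x = 0 -> hopf_axioms_at x.
Proof.
move=> Dx Dg Dk Ex Eg Ek Sxl Sxr; rewrite /hopf_axioms_at Dx.
split; rewrite ?tens_liftD // ?tens_liftE // ?Ex ?scale0r //.
- rewrite !linearD /= !tens_mapE /= Dx Dg Dk pureDl pureDr linearD /=.
  by rewrite !tens_assocE addrA.
- by rewrite linearD /= !contractlE /= Ex Ek scale0r scale1r add0r.
- by rewrite linearD /= !contractrE /= Ex Eg scale0r scale1r addr0.
Qed.

Variables (R : algType K) (HR : hopf_structure R) (iota : {lrmorphism R -> B}).
Hypotheses (Diota : forall a, D (iota a) = tens_map iota iota (comul HR a))
  (Eiota : forall a, E (iota a) = counit HR a)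
  (Siota : forall a, S (iota a) = iota (antipode HR a)).

Lemma hopf_axioms_base a : hopf_axioms_at (iota a).
Proof.
rewrite /hopf_axioms_at Diota Eiota; split.
(* Naturality of the associator: [iota] moves outwards, so that coassociativity in [R] applies. *)
- have nat t : tens_assoc (tens_map D idfun (tens_map iota iota t)) =
    tens_map iota (tens_map iota iota) (tens_assoc (tens_map (comul HR) idfun t)).
    elim/tens_ind: t => [b c||t t' IH IH'].
    + rewrite !tens_mapE /= Diota.
      elim/tens_ind: (comul HR b) => [b' c'||t t' IH IH'].
      * by rewrite !tens_mapE !tens_assocE !tens_mapE /= tens_mapE.
      * by rewrite !(linear0, pure0l).
      * by rewrite !(linearD, pureDl) /= IH IH'.
    + by rewrite !linear0.
    + by rewrite !linearD /= IH IH'.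
  rewrite nat comul_coassoc.
  elim/tens_ind: (comul HR a) => [b c||t t' IH IH'].
  + by rewrite !tens_mapE /= Diota.
  + by rewrite !linear0.
  + by rewrite !linearD /= IH IH'.
- rewrite -[in RHS](counitl HR a).
  have bl := scaler_bilin R (counit HR).
  elim/tens_ind: (comul HR a) => [b c||t t' IH IH'].
  + by rewrite tens_mapE contractlE tens_liftE //= Eiota linearZ.
  + by rewrite tens_lift0 // !linear0.
  + by rewrite tens_liftD // !linearD /= IH IH'.
- rewrite -[in RHS](counitr HR a).
  have br := scalel_bilin R (counit HR).
  elim/tens_ind: (comul HR a) => [b c||t t' IH IH'].
  + by rewrite tens_mapE contractrE tens_liftE //= Eiota linearZ.
  + by rewrite tens_lift0 // !linear0.
  + by rewrite tens_liftD // !linearD /= IH IH'.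
- have := congr1 iota (antipodel HR a); rewrite linearZ rmorph1 => <-.
  have bl := antipode_bilinl HR.
  elim/tens_ind: (comul HR a) => [b c||t t' IH IH'].
  + by rewrite tens_mapE !tens_liftE // /Sl Siota rmorphM.
  + by rewrite linear0 !tens_lift0 // linear0.
  + by rewrite linearD !tens_liftD // linearD /= IH IH'.
- have := congr1 iota (antipoder HR a); rewrite linearZ rmorph1 => <-.
  have br := antipode_bilinr HR.
  elim/tens_ind: (comul HR a) => [b c||t t' IH IH'].
  + by rewrite tens_mapE !tens_liftE // /Sr Siota rmorphM.
  + by rewrite linear0 !tens_lift0 // linear0.
  + by rewrite linearD !tens_liftD // linearD /= IH IH'.
Qed.

End HopfAxiomsAt.

(** * From multiplicative linear maps to algebra morphisms *)

Section BundleMorphism.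
Variables (K : comNzRingType) (A B C : algType K).

(** [ambiskew_lift] provides a linear map with a multiplicativity equation, whereas [hopf_structure]
    asks for a bundled morphism. *)
Lemma lrmorphism_tens (f : {linear A -> tens B C}) : monoid_morphism f ->
  exists g : {lrmorphism A -> tens B C}, g =1 f.
Proof.
move=> fM; pose g : {lrmorphism A -> tens B C} := HB.pack (f : A -> tens B C)
  (GRing.isLinear.Build K A (tens B C) _ f (linearP f))
  (GRing.isMonoidMorphism.Build A (tens B C) f fM).
by exists g.
Qed.

Lemma lrmorphism_scalar (f : {linear A -> K^o}) : monoid_morphism f ->
  exists g : {lrmorphism A -> K^o}, g =1 f.
Proof.
move=> fM; pose g : {lrmorphism A -> K^o} := HB.pack (f : A -> K^o)
  (GRing.isLinear.Build K A K^o _ f (linearP f))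
  (GRing.isMonoidMorphism.Build A K^o f fM).
by exists g.
Qed.

End BundleMorphism.

(** * Sufficiency: construction of the Hopf structure on A *)

Section Sufficiency.
Variables (K : fieldType) (R : comUnitAlgType K) (sigma : alg_aut R).
Variables (h : R) (xi : K) (xi_neq0 : xi != 0).
Local Notation A := (ambiskew sigma h xi).
Local Notation ib := (@ambi_base K R sigma h xi).
Variables (HR : hopf_structure R) (rp rm lp lm sp sm : R).
Hypotheses
  (comul_sl : forall a, tens_map sigma idfun (comul HR a) = comul HR (sigma a))
  (comul_sr : forall a, comul HR (sigma a) = tens_map idfun sigma (comul HR a))
  (antipode_s : forall a, antipode HR (sigma a) = aut_inv sigma (antipode HR a)).
Hypotheses (comulh : comul HR h = h ⊗ (rp * rm) + (lp * lm) ⊗ h)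
  (counith : counit HR h = 0)
  (ulr : lp * lm * rp * rm \is a GRing.unit)
  (antipodeh : antipode HR h = - (lp * lm * rp * rm)^-1 * h).
Hypotheses (grp : grouplike HR rp) (grm : grouplike HR rm)
  (glp : grouplike HR lp) (glm : grouplike HR lm)
  (lprm : sigma lp ⊗ sigma rm = xi *: (lp ⊗ rm))
  (lmrp : sigma lm ⊗ sigma rp = xi *: (lm ⊗ rp)).
Hypotheses (usp : sp \is a GRing.unit) (spE : sp^-1 = - (lp * sigma rp))
  (usm : sm \is a GRing.unit) (smE : sm^-1 = - (lm * aut_inv sigma rm)).

(** Passing [X ⊗ ib r] across a tensor applies [tau] to its first factor, passing [ib l ⊗ X] applies
    it to the second; the two compatibilities of [tau] with Delta make the results agree. *)
Lemma skew_comul_rel (X : A) (tau : alg_aut R) (l r a : R) :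
  (forall b, X * ib b = ib (tau b) * X) ->
  tens_map tau idfun (comul HR a) = comul HR (tau a) ->
  comul HR (tau a) = tens_map idfun tau (comul HR a) ->
  (X ⊗ ib r + ib l ⊗ X) * tens_map ib ib (comul HR a) =
  tens_map ib ib (comul HR (tau a)) * (X ⊗ ib r + ib l ⊗ X).
Proof.
move=> Xb tl tr.
have pl t : (X ⊗ ib r) * tens_map ib ib t =
    tens_map ib ib (tens_map tau idfun t) * (X ⊗ ib r).
  elim/tens_ind: t => [b c||t t' IH IH'].
  - by rewrite !tens_mapE !tens_mulE /= Xb -!rmorphM (mulrC r).
  - by rewrite !linear0 mulr0 mul0r.
  - by rewrite !linearD /= mulrDr mulrDl IH IH'.
have pr t : (ib l ⊗ X) * tens_map ib ib t =
    tens_map ib ib (tens_map idfun tau t) * (ib l ⊗ X).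
  elim/tens_ind: t => [b c||t t' IH IH'].
  - by rewrite !tens_mapE !tens_mulE /= Xb -!rmorphM (mulrC l).
  - by rewrite !linear0 mulr0 mul0r.
  - by rewrite !linearD /= mulrDr mulrDl IH IH'.
by rewrite mulrDl mulrDr pl pr tl tr.
Qed.

(** Condition 1 passes to the inverse automorphism, as the relation for [Xminus] requires. *)
Lemma comul_aut_inv a :
  tens_map (aut_inv sigma) idfun (comul HR a) = comul HR (aut_inv sigma a) /\
  comul HR (aut_inv sigma a) = tens_map idfun (aut_inv sigma) (comul HR a).
Proof.
have Kl (t : tens R R) :
    tens_map (aut_inv sigma) idfun (tens_map sigma idfun t) = t.
  elim/tens_ind: t => [b c||t t' IH IH'].
  - by rewrite !tens_mapE /= aut_funK.
  - by rewrite !linear0.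
  - by rewrite !linearD /= IH IH'.
have Kr (t : tens R R) :
    tens_map idfun (aut_inv sigma) (tens_map idfun sigma t) = t.
  elim/tens_ind: t => [b c||t t' IH IH'].
  - by rewrite !tens_mapE /= aut_funK.
  - by rewrite !linear0.
  - by rewrite !linearD /= IH IH'.
split; first by rewrite -{1}(aut_invK sigma a) -comul_sl Kl.
by rewrite -{2}(aut_invK sigma a) comul_sr Kr.
Qed.

(** Linearity in [a] allows identities in R ⊗ R to be carried to A ⊗ A, with a generator attached to
    each factor. *)
Definition base_mul (x : A) (a : R) : A := ib a * x.
Lemma base_mul_linear x : linear (base_mul x).
Proof. by move=> c a b; rewrite /base_mul linearP mulrDl scalerAl. Qed.
HB.instance Definition _ x :=
  GRing.isLinear.Build K R A _ (base_mul x) (base_mul_linear x).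

Lemma ambiskew_comul : exists D : {lrmorphism A -> tens A A},
  [/\ forall a, D (ib a) = tens_map ib ib (comul HR a),
      D Xplus = Xplus ⊗ ib rp + ib lp ⊗ Xplus
    & D Xminus = Xminus ⊗ ib rm + ib lm ⊗ Xminus].
Proof.
pose f : {linear R -> tens A A} := tens_map ib ib \o comul HR.
have f1 : f 1 = 1 by rewrite /f /= rmorph1 tens_mapE /= rmorph1.
have fM a b : f (a * b) = f a * f b by rewrite /f /= rmorphM tens_mapM.
have rel_p a := skew_comul_rel lp rp
  (Xplus_base sigma h xi) (comul_sl a) (comul_sr a).
have rel_m a := skew_comul_rel (tau := aut_inverse sigma) lm rm
  (Xminus_base sigma h xi) (proj1 (comul_aut_inv a)) (proj2 (comul_aut_inv a)).
(* Condition 3 is carried to A ⊗ A with sigma^-1 applied on the factor of [Xminus]; this matches the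
   mixed terms of [skew_relation_comul] exactly. *)
have cross1 := congr1
  (tens_map (base_mul Xplus) (base_mul Xminus \o aut_inv sigma)) lmrp.
have cross2 := congr1
  (tens_map (base_mul Xminus \o aut_inv sigma) (base_mul Xplus)) lprm.
rewrite linearZ /= !tens_mapE /= /base_mul aut_funK in cross1.
rewrite linearZ /= !tens_mapE /= /base_mul aut_funK in cross2.
have rel_pm :
    (Xplus ⊗ ib rp + ib lp ⊗ Xplus) * (Xminus ⊗ ib rm + ib lm ⊗ Xminus) =
    f h + xi *: ((Xminus ⊗ ib rm + ib lm ⊗ Xminus) *
                 (Xplus ⊗ ib rp + ib lp ⊗ Xplus)).
  apply/eqP; rewrite -subr_eq skew_relation_comul cross1 cross2 !subrr !addr0.
  by rewrite /f /= comulh linearD /= !tens_mapE.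
have [D [Db Dp Dm DM]] := ambiskew_lift (@mulrA (tens A A)) (@mul1r (tens A A))
  (@mulr1 (tens A A)) (tens_mul_bilin A A) f1 fM rel_p rel_m rel_pm.
have D1 : monoid_morphism D by split=> //; rewrite -[1]/(ib 1) Db.
have [D' D'E] := lrmorphism_tens D1.
by exists D'; split=> [a||]; rewrite D'E; [apply: Db | apply: Dp | apply: Dm].
Qed.

(** With both generators sent to 0 the commutation relations become trivial, and the remaining
    relation says that the counit kills [h]. *)
Lemma ambiskew_counit : exists E : {lrmorphism A -> K^o},
  [/\ forall a, E (ib a) = counit HR a, E Xplus = 0 & E Xminus = 0].
Proof.
have [|||E [Eb Ep Em EM]] := ambiskew_lift (sigma := sigma) (h := h) (xi := xi)
  (@mulrA K^o) (@mul1r K^o) (@mulr1 K^o) (mul_bilin K^o)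
  (f := counit HR) (xp := 0) (xm := 0) (rmorph1 _) (rmorphM _).
- by move=> a; rewrite mul0r mulr0.
- by move=> a; rewrite mul0r mulr0.
- by rewrite /= counith !mul0r scaler0 addr0.
have E1 : monoid_morphism E by split=> //; rewrite -[1]/(ib 1) Eb rmorph1.
have [E' E'E] := lrmorphism_scalar E1.
by exists E'; split=> [a||]; rewrite E'E; [apply: Eb | apply: Ep | apply: Em].
Qed.

Let k : R := lp * lm * rp * rm.

(** The coefficient of X_+ X_- in S(X_+) S(X_-). By condition 4 its inverse is lp rm sigma(lm)
    sigma(rp), which condition 3 turns into xi [k]. *)
Lemma antipode_coef_plus : sp * sigma sm = xi^-1 *: k^-1.
Proof.
have usm' : sigma sm \is a GRing.unit by apply: rmorph_unit.
(* The multiplication of [R] is applied to the tensor identity [lmrp]. *)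
have e : sigma lm * sigma rp = xi *: (lm * rp).
  have := congr1 (tens_lift *%R) lmrp; have bR := mul_bilin R.
  by rewrite tens_liftZ // !tens_liftE.
rewrite -[LHS]invrK invrM // spE -rmorphV // smE.
rewrite rmorphN rmorphM /= aut_invK mulrNN.
rewrite (_ : _ * _ = xi *: k) ?invrZ ?unitfE //.
rewrite [LHS](AC (2*2) (1*4*(2*3)))%AC /= e -scalerAl /k.
by rewrite [lm * rp * _](AC (2*2) (4*1*2*3))%AC.
Qed.

Lemma antipode_coef_minus : sm * aut_inv sigma sp = xi *: k^-1.
Proof.
have usp' : aut_inv sigma sp \is a GRing.unit by apply: rmorph_unit.
have e : aut_inv sigma lp * aut_inv sigma rm = xi^-1 *: (lp * rm).
  have := congr1 (tens_lift *%R) lprm; have bR := mul_bilin R.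
  rewrite tens_liftZ // !tens_liftE // => /(congr1 (aut_inv sigma)).
  rewrite linearZ !rmorphM /= !aut_funK => ->.
  by rewrite scalerA mulVf // scale1r.
rewrite -[LHS]invrK invrM // -rmorphV // spE smE.
rewrite rmorphN rmorphM /= aut_funK mulrNN.
rewrite (_ : _ * _ = xi^-1 *: k) ?invrZ ?invrK ?unitfE ?invr_eq0 //.
rewrite [LHS](AC (2*2) (1*4*(2*3)))%AC /= e -scalerAl /k.
by rewrite [lp * rm * _](AC (2*2) (1*4*3*2))%AC.
Qed.

(** An anti-homomorphism is a homomorphism into the opposite algebra, so the universal property is
    used with the product [opmul]. *)
Lemma ambiskew_antipode : exists S : {linear A -> A},
  [/\ forall a, S (ib a) = ib (antipode HR a),
      S Xplus = ib sp * Xplus, S Xminus = ib sm * Xminus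
    & forall x y, S (x * y) = S y * S x].
Proof.
pose opmul (x y : A) := y * x.
have bA : bilin opmul.
  have [bl br] := mul_bilin A; split=> [v|u]; [exact: br | exact: bl].
have opA : associative opmul by move=> x y z; rewrite /opmul mulrA.
pose f : {linear R -> A} := ib \o antipode HR.
have f1 : f 1 = 1 by rewrite /f /= antipode1 rmorph1.
have fM a b : f (a * b) = opmul (f a) (f b).
  by rewrite /f /= antipodeM rmorphM.
have antipode_inv a :
    aut_inv sigma (antipode HR (aut_inv sigma a)) = antipode HR a.
  by rewrite -antipode_s aut_invK.
have rel_p a : opmul (ib sp * Xplus) (f a) = opmul (f (sigma a)) (ib sp * Xplus).
  rewrite /opmul /f /= -mulrA Xplus_base antipode_s aut_invK !mulrA.
  by rewrite -!rmorphM mulrC.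
have rel_m a :
    opmul (ib sm * Xminus) (f a) = opmul (f (aut_inv sigma a)) (ib sm * Xminus).
  rewrite /opmul /f /= -mulrA Xminus_base antipode_inv !mulrA.
  by rewrite -!rmorphM mulrC.
(* Once X_+ X_- is expanded, the terms in [h] cancel against S(h) and both sides equal xi k^-1 X_-
   X_+. *)
have rel_pm : opmul (ib sp * Xplus) (ib sm * Xminus) =
    f h + xi *: opmul (ib sm * Xminus) (ib sp * Xplus).
  rewrite /opmul /f /= -!mulrA ![_ * (ib _ * _)]mulrA Xplus_base Xminus_base.
  rewrite -!mulrA Xplus_Xminus !mulrA -!rmorphM.
  rewrite antipode_coef_plus antipode_coef_minus mulrDr antipodeh /=.
  rewrite mulNr rmorphN rmorphM /= !linearZ /= -/k -!scalerAl -!scalerAr.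
  by rewrite scalerDr !scalerA mulfV // !mul1r scale1r addKr mulrA.
have [S [Sb Sp Sm SM]] := ambiskew_lift opA (@mulr1 A) (@mul1r A) bA f1 fM
  rel_p rel_m rel_pm.
by exists S; split.
Qed.

Lemma ambiskew_hopf_structure : exists HA : hopf_structure A,
  [/\ hopf_extends ambi_base HR HA,
      comul HA Xplus = Xplus ⊗ ambi_base rp + ambi_base lp ⊗ Xplus /\
      comul HA Xminus = Xminus ⊗ ambi_base rm + ambi_base lm ⊗ Xminus,
      counit HA Xplus = 0 /\ counit HA Xminus = 0
    & antipode HA Xplus = ambi_base sp * Xplus /\
      antipode HA Xminus = ambi_base sm * Xminus].
Proof.
have [D [Db Dp Dm]] := ambiskew_comul.
have [E [Eb Ep Em]] := ambiskew_counit.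
have [S [Sb Sp Sm SM]] := ambiskew_antipode.
have [urp ulp urm ulm] : [/\ rp \is a GRing.unit, lp \is a GRing.unit,
    rm \is a GRing.unit & lm \is a GRing.unit].
  by move: ulr; rewrite !unitrM => /andP[/andP[/andP[-> ->] ->] ->].
have usplit g : grouplike HR g -> g \is a GRing.unit ->
    [/\ D (ib g) = ib g ⊗ ib g, E (ib g) = 1 & S (ib g) = ib g^-1].
  move=> gg ug; have eg := grouplike_counit gg ug.
  have [_ Sg] := grouplike_unit gg eg.
  by rewrite Db gg tens_mapE Eb eg Sb Sg.
have [Drp Erp Srp] := usplit _ grp urp; have [Drm Erm Srm] := usplit _ grm urm.
have [Dlp Elp Slp] := usplit _ glp ulp; have [Dlm Elm Slm] := usplit _ glm ulm.
(* These are the coefficients of the generator in the two antipode axioms; [r] stands for [sigma rp]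
   or [aut_inv sigma rm], since the generator is moved to the right of it. *)
have coefs (s l r : R) : s \is a GRing.unit -> l \is a GRing.unit ->
    r \is a GRing.unit -> s^-1 = - (l * r) -> s * r + l^-1 = 0 /\ r^-1 + l * s = 0.
  move=> us ul ur sE; have s1 : s * (l * r) = -1.
    by rewrite -[l * r]opprK -sE mulrN mulrV.
  split.
    by apply: (mulIr ul); rewrite mulrDl mulVr // mul0r mulrAC -mulrA s1 addNr.
  apply: (mulIr ur); rewrite mulrDl mulVr // mul0r mulrAC [_ * s]mulrC s1.
  by rewrite subrr.
have [cpl cpr] := coefs _ _ _ usp ulp (rmorph_unit sigma urp) spE.
have [cml cmr] := coefs _ _ _ usm ulm (rmorph_unit (aut_inv sigma) urm) smE.
have ax x : hopf_axioms_at D E S x.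
  elim/ambiskew_ind: x => [a|||x y|x y].
  - exact: (hopf_axioms_base Db Eb Sb).
  - apply: (hopf_axioms_skew Dp) => //.
      rewrite Sp Slp -mulrA Xplus_base mulrA -rmorphM -mulrDl -rmorphD.
      by rewrite cpl rmorph0 mul0r.
    rewrite Sp Srp Xplus_base mulrA -rmorphM -mulrDl -rmorphD.
    by rewrite rmorphV // cpr rmorph0 mul0r.
  - apply: (hopf_axioms_skew Dm) => //.
      rewrite Sm Slm -mulrA Xminus_base mulrA -rmorphM -mulrDl -rmorphD.
      by rewrite cml rmorph0 mul0r.
    rewrite Sm Srm Xminus_base mulrA -rmorphM -mulrDl -rmorphD.
    by rewrite rmorphV // cmr rmorph0 mul0r.
  - exact: hopf_axiomsD.
  - exact: hopf_axiomsM.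
have S1 : S 1 = 1 by rewrite -[1]/(ib 1) Sb antipode1.
exists (@HopfStructure K A D E S S1 SM (fun x => let: And5 p _ _ _ _ := ax x in p)
  (fun x => let: And5 _ p _ _ _ := ax x in p)
  (fun x => let: And5 _ _ p _ _ := ax x in p)
  (fun x => let: And5 _ _ _ p _ := ax x in p)
  (fun x => let: And5 _ _ _ _ p := ax x in p)).
by split.
Qed.

End Sufficiency.

(** The inverse is a total function that returns its argument on non-units, hence the invertibility
    claims beside the formulas for the antipode of [h] and for [sp] and [sm]. *)
Theorem theorem3p1 (K : closedFieldType) (charK : [pchar K] =i pred0)
    (R : comUnitAlgType K) (fgR : finitely_generated R)
    (sigma : alg_aut R) (h : R) (xi : K) (xi_neq0 : xi != 0)
    (HR : hopf_structure R) (rp rm lp lm sp sm : R) :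
  (exists HA : hopf_structure (ambiskew sigma h xi),
    [/\ hopf_extends ambi_base HR HA,
        comul HA Xplus = Xplus ⊗ ambi_base rp + ambi_base lp ⊗ Xplus /\
        comul HA Xminus = Xminus ⊗ ambi_base rm + ambi_base lm ⊗ Xminus,
        counit HA Xplus = 0 /\ counit HA Xminus = 0
      & antipode HA Xplus = ambi_base sp * Xplus /\
        antipode HA Xminus = ambi_base sm * Xminus])
  <->
  [/\ [/\ forall a, tens_map sigma idfun (comul HR a) = comul HR (sigma a),
          forall a, comul HR (sigma a) = tens_map idfun sigma (comul HR a)
        & forall a, antipode HR (sigma a) = aut_inv sigma (antipode HR a)],
      [/\ comul HR h = h ⊗ (rp * rm) + (lp * lm) ⊗ h,
          counit HR h = 0,
          lp * lm * rp * rm \is a GRing.unit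
        & antipode HR h = - (lp * lm * rp * rm)^-1 * h],
      [/\ [/\ grouplike HR rp, grouplike HR rm,
              grouplike HR lp & grouplike HR lm],
          sigma lp ⊗ sigma rm = xi *: (lp ⊗ rm)
        & sigma lm ⊗ sigma rp = xi *: (lm ⊗ rp)]
    & [/\ sp \is a GRing.unit, sp^-1 = - (lp * sigma rp),
          sm \is a GRing.unit & sm^-1 = - (lm * aut_inv sigma rm)]].
Proof.
split=> [[HA [ext [comulp comulm] [counitp counitm] [antip antim]]]|].
  have [sk [grp grm glp glm] _ coefs] := hopf_extension_skew xi_neq0 ext
    comulp comulm counitp counitm antip antim.
  have [coh eh lprm lmrp] := hopf_extension_relation xi_neq0 ext
    comulp comulm counitp.
  have [ulr Sh] := hopf_extension_antipode xi_neq0 ext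
    comulp comulm counitp counitm antip antim.
  by split.
move=> [[sl sr Ss] [coh eh ulr Sh] [[grp grm glp glm] lprm lmrp]
  [usp spE usm smE]].
exact: (ambiskew_hopf_structure xi_neq0 sl sr Ss coh eh ulr Sh grp grm glp glm
  lprm lmrp usp spE usm smE).
Qed.
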